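(* For each $n\in\mathbb{N}$ let $\mathcal{H}^{(n)}$ be a finite dimensional Hilbert space, $\rho^{(n)}$ and $\sigma^{(n)}$ quantum states on $\mathcal{H}^{(n)}$, $X^{(n)}=(X_1^{(n)},\dots,X_d^{(n)})$ a list of observables on $\mathcal{H}^{(n)}$, and $R^{(n)}$ (a version of) the square-root likelihood ratio $\mathcal{R}(\sigma^{(n)}\mid\rho^{(n)})$. Suppose that there exist a sequence $O^{(n)}=o_{L^2}(\rho^{(n)})$ of observables satisfying $R^{(n)}+O^{(n)}>0$, and a sequence $\tilde O^{(n)}=o_D\big(\log(R^{(n)}+O^{(n)}),\rho^{(n)}\big)$ of observables satisfying $$\begin{pmatrix}X^{(n)}\\ 2\log(R^{(n)}+O^{(n)})-\tilde O^{(n)}\end{pmatrix}\ \overset{\rho^{(n)}}{\rightsquigarrow}\ N\left(\begin{pmatrix}\mu\\ -\frac12s^2\end{pmatrix},\begin{pmatrix}\Sigma&\kappa\\ \kappa^*&s^2\end{pmatrix}\right),$$ where $\mu\in\mathbb{R}^d$, $s\in\mathbb{R}$, $\kappa\in\mathbb{C}^d$, and $\Sigma$ is a $d\times d$ complex Hermitian positive semidefinite matrix. Then $$\sigma^{(n)}\vartriangleleft\rho^{(n)}\qquad\text{and}\qquad X^{(n)}\ \overset{\sigma^{(n)}}{\rightsquigarrow}\ N(\mu+\mathrm{Re}(\kappa),\Sigma).$$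
   Context: Summation over repeated indices $i,j$ is understood; $\prod_{t=1}^rA_t=A_1A_2\cdots A_r$. Quantum states are density operators; observables on finite dimensional spaces are Hermitian operators. ''Positive'' means positive semidefinite; $A>0$ means strictly positive. Square-root likelihood ratio: for positive operators on a finite dimensional Hilbert space $\mathcal{H}$, $\mathrm{supp}\,\rho:=(\ker\rho)^\perp$; $\sigma\!\downharpoonleft_{\mathrm{supp}\,\rho}:=\iota_\rho^*\sigma\iota_\rho$ with $\iota_\rho:\mathrm{supp}\,\rho\hookrightarrow\mathcal{H}$ the inclusion; $\rho\perp\sigma$ means $\sigma\!\downharpoonleft_{\mathrm{supp}\,\rho}=0$ (a symmetric relation). A version of $\mathcal{R}(\sigma\mid\rho)$ is any positive operator $R$ such that $\sigma=R\rho R+\tau$ with $\tau\ge0$, $\tau\perp\rho$ (such $R$ exists). Contiguity: $O^{(n)}=o_{L^2}(\rho^{(n)})$ ($L^2$-infinitesimal) means $\lim_n\mathrm{Tr}\,\rho^{(n)}O^{(n)2}=0$. Let $\mathbf{1}_M(x)=1$ if $|x|\le M$ and $0$ otherwise. For positive operators $A^{(n)}$, $A^{(n)2}$ is uniformly integrable under $\rho^{(n)}$ if for every $\varepsilon>0$ there is $M>0$ with $\sup_n\mathrm{Tr}\,\rho^{(n)}A^{(n)2}(I-\mathbf{1}_M(A^{(n)}))<\varepsilon$. $\sigma^{(n)}\vartriangleleft\rho^{(n)}$ means: with $R^{(n)}$ a version of $\mathcal{R}(\sigma^{(n)}\mid\rho^{(n)})$, (i) $\lim_n\mathrm{Tr}\,\rho^{(n)}R^{(n)2}=1$,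 and (ii) there is a sequence $O'^{(n)}=o_{L^2}(\rho^{(n)})$ of observables such that $R^{(n)}+O'^{(n)}$ is positive and $(R^{(n)}+O'^{(n)})^2$ is uniformly integrable under $\rho^{(n)}$ (independent of the version). D-infinitesimal: $\tilde O^{(n)}=o_D(Z^{(n)},\rho^{(n)})$ means $$\lim_{n\to\infty}\mathrm{Tr}\,\rho^{(n)}\prod_{t=1}^re^{\sqrt{-1}(\xi_tZ^{(n)}+\eta_t\tilde O^{(n)})}=\lim_{n\to\infty}\mathrm{Tr}\,\rho^{(n)}\prod_{t=1}^re^{\sqrt{-1}\xi_tZ^{(n)}}$$ for all $r\in\mathbb{N}$ and $\{\xi_t\}_{t=1}^r,\{\eta_t\}_{t=1}^r\subset\mathbb{R}$. Convergence to a quantum Gaussian state: for $h\in\mathbb{R}^m$ and a Hermitian positive semidefinite $m\times m$ matrix $J=V+\sqrt{-1}S$ ($V$ real symmetric, $S$ real skew-symmetric), $N(h,J)$ is the state $\phi$ on the algebra generated by canonical observables $Y_1,\dots,Y_m$ with $\frac{\sqrt{-1}}{2}[Y_i,Y_j]=S_{ij}$ having characteristic function $\phi(e^{\sqrt{-1}\xi^iY_i})=e^{\sqrt{-1}\xi^ih_i-\frac12\xi^i\xi^jV_{ij}}$; its quasi-characteristic function is $$\phi\Big(\prod_{t=1}^re^{\sqrt{-1}\xi_t^iY_i}\Big)=\exp\Big(\sum_{t=1}^r\big(\sqrt{-1}\xi_t^ih_i-\tfrac12\xi_t^i\xi_t^jJ_{ji}\big)-\sum_{t=1}^r\sum_{u=t+1}^r\xi_t^i\xi_u^jJ_{ji}\Big).$$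 For a list $Y^{(n)}=(Y_1^{(n)},\dots,Y_m^{(n)})$ of observables and states $\rho^{(n)}$ on $\mathcal{H}^{(n)}$, $Y^{(n)}\overset{\rho^{(n)}}{\rightsquigarrow}N(h,J)$ means that $\lim_n\mathrm{Tr}\,\rho^{(n)}\prod_{t=1}^re^{\sqrt{-1}\xi_t^iY_i^{(n)}}$ equals this right-hand side for all $r\in\mathbb{N}$ and $\{\xi_t\}_{t=1}^r\subset\mathbb{R}^m$. *)

(* Defs.v *)
(* A finite dimensional Hilbert space is identified with C^k, whose vectors are
   the columns 'cV[R[i]]_k and whose operators are the matrices 'M[R[i]]_k; a
   sequence H^(n) is given by its dimensions k : nat -> nat, and a sequence of
   operators is a dependent family forall n, 'M[R[i]]_(k n). *)
From HB Require Import structures.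
From mathcomp Require Import all_boot all_order all_algebra.
From mathcomp Require Import complex.
From mathcomp Require Import all_classical all_reals all_analysis.

Set Implicit Arguments.
Unset Strict Implicit.
Unset Printing Implicit Defensive.

Import Order.TTheory GRing.Theory Num.Theory.
Import numFieldNormedType.Exports.

Local Open Scope classical_set_scope.
Local Open Scope sesquilinear_scope.
Local Open Scope complex_scope.
Local Open Scope ring_scope.

Section Operators.
Variables (R : realType) (k : nat).
Implicit Types (A O Z rho sigma : 'M[R[i]]_k).

Definition observable A : Prop := A \is hermsymmx.

(* In the order of R[i], 0 <= z means that z is real and nonnegative. *)
Definition psd A : Prop :=
  A \is hermsymmx /\ forall x : 'cV[R[i]]_k, 0 <= (x ^t* *m A *m x) 0 0.

Definition pd A : Prop :=
  A \is hermsymmx /\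
  forall x : 'cV[R[i]]_k, x != 0 -> 0 < (x ^t* *m A *m x) 0 0.

Definition state rho : Prop := psd rho /\ \tr rho = 1.

(* (ker rho)^\perp *)
Definition supp rho : set 'cV[R[i]]_k :=
  [set x | forall z : 'cV[R[i]]_k, rho *m z = 0 -> (z ^t* *m x) 0 0 = 0].

(* rho _|_ sigma: the operator iota^* sigma iota on supp rho vanishes, i.e. all
   its matrix elements <x, sigma y> with x, y in supp rho do. *)
Definition perp rho sigma : Prop :=
  forall x y : 'cV[R[i]]_k, supp rho x -> supp rho y ->
    (x ^t* *m sigma *m y) 0 0 = 0.

(* L is a version of the square-root likelihood ratio R(sigma | rho). *)
Definition sqrt_lr sigma rho (L : 'M[R[i]]_k) : Prop :=
  psd L /\
  exists tau, [/\ psd tau, perp tau rho & sigma = L *m rho *m L + tau].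

(* Functional calculus f(A) of a Hermitian matrix A = P^-1 diag(a) P with P
   unitary: f(A) = P^-1 diag(f(a)) P. The entries of spectral_diag A are then
   real complex numbers. *)
Definition hfun (f : R -> R[i]) A : 'M[R[i]]_k :=
  invmx (spectralmx A)
    *m diag_mx (map_mx (fun z : R[i] => f (complex.Re z)) (spectral_diag A))
    *m spectralmx A.

Definition cexp (z : R[i]) : R[i] :=
  (expR (complex.Re z))%:C * (cos (complex.Im z) +i* sin (complex.Im z)).

(* e^{sqrt(-1) A} *)
Definition mexpi A : 'M[R[i]]_k := hfun (fun x => cexp (0 +i* x)) A.

Definition mlog A : 'M[R[i]]_k := hfun (fun x => (ln x)%:C) A.

(* 1_M(A) *)
Definition mtrunc (M : R) A : 'M[R[i]]_k :=
  hfun (fun x => if `|x| <= M then 1 else 0) A.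

(* The list (X_1, ..., X_d, Z). *)
Definition rcons_obs (d : nat) (X : 'I_d -> 'M[R[i]]_k) Z :
    'I_(d + 1) -> 'M[R[i]]_k :=
  fun i => match fintype.split i with inl j => X j | inr _ => Z end.

End Operators.

Section Asymptotics.
Variables (R : realType) (k : nat -> nat).
Implicit Types (A O Z rho sigma : forall n, 'M[R[i]]_(k n)).

(* R[i]^o is R[i] with the topology of the modulus. *)
Definition o_L2 rho O : Prop :=
  (fun n => \tr (rho n *m (O n *m O n))) @ \oo --> (0 : R[i]^o).

(* A^2 is uniformly integrable under rho. The trace is real when A is Hermitian
   and rho is a state; the supremum is taken in the extended reals because the
   real-valued sup of an unbounded set is 0. *)
Definition sq_unif_integrable rho A : Prop :=
  forall e : R, 0 < e -> exists2 M : R, 0 < M &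
    (ereal_sup (range (fun n => (complex.Re
       (\tr (rho n *m (A n *m A n) *m (1%:M - mtrunc M (A n)))))%:E))
     < e%:E)%E.

(* sigma <| rho. The two conditions do not depend on the choice of the versions
   L n; they are required here for every choice. *)
Definition contiguous sigma rho : Prop :=
  forall L : (forall n, 'M[R[i]]_(k n)),
    (forall n, sqrt_lr (sigma n) (rho n) (L n)) ->
    (fun n => \tr (rho n *m (L n *m L n))) @ \oo --> (1 : R[i]^o) /\
    exists O' : (forall n, 'M[R[i]]_(k n)),
      [/\ forall n, observable (O' n),
          o_L2 rho O',
          forall n, psd (L n + O' n)
        & sq_unif_integrable rho (fun n => L n + O' n)].

(* O = o_D(Z, rho): both limits exist and they coincide. *)
Definition o_D Z rho O : Prop :=
  forall (r : nat) (xi eta : 'I_r -> R), exists l : R[i],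
    (fun n => \tr (rho n *m
       \prod_(t < r) mexpi ((xi t)%:C *: Z n + (eta t)%:C *: O n)))
      @ \oo --> (l : R[i]^o) /\
    (fun n => \tr (rho n *m \prod_(t < r) mexpi ((xi t)%:C *: Z n)))
      @ \oo --> (l : R[i]^o).

(* The quasi-characteristic function of the quantum Gaussian state N(h, J) at
   (xi_1, ..., xi_r). *)
Definition gauss_qchar (m : nat) (h : 'cV[R]_m) (J : 'M[R[i]]_m)
    (r : nat) (xi : 'I_r -> 'cV[R]_m) : R[i] :=
  cexp (\sum_(t < r)
          ((0 +i* \sum_(i < m) xi t i 0 * h i 0)
           - 2^-1 * \sum_(i < m) \sum_(j < m)
                      (xi t i 0 * xi t j 0)%:C * J j i)
        - \sum_(t < r) \sum_(u < r | (t < u)%N)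
            \sum_(i < m) \sum_(j < m) (xi t i 0 * xi u j 0)%:C * J j i).

(* Y ~> N(h, J) under rho. *)
Definition qconv_gauss rho (m : nat) (Y : forall n, 'I_m -> 'M[R[i]]_(k n))
    (h : 'cV[R]_m) (J : 'M[R[i]]_m) : Prop :=
  forall (r : nat) (xi : 'I_r -> 'cV[R]_m),
    (fun n => \tr (rho n *m
       \prod_(t < r) mexpi (\sum_(i < m) (xi t i 0)%:C *: Y n i)))
      @ \oo --> (gauss_qchar h J xi : R[i]^o).

End Asymptotics.

(* Main.v *)
Require Import Defs.
From HB Require Import structures.
From mathcomp Require Import all_boot all_order all_algebra.
From mathcomp Require Import complex ring lra.
From mathcomp Require Import all_classical all_reals all_analysis.
From mathcomp Require Import measurable_realfun.

Set Implicit Arguments.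
Unset Strict Implicit.
Unset Printing Implicit Defensive.

Import Order.TTheory GRing.Theory Num.Theory.
Import numFieldNormedType.Exports.
Import Normc.

Local Open Scope classical_set_scope.
Local Open Scope sesquilinear_scope.
Local Open Scope complex_scope.
Local Open Scope ring_scope.

(** Put B = L + O, Z = log B and W = 2 Z - Ot, and write Pi for a product of
    unitaries exp (i xi X). Since sigma is L rho L up to a small remainder,
    Tr sigma Pi is close to Tr rho (B Pi B): the state is reweighted by the
    likelihood ratio from both sides. The difficulty is that B = exp Z is an
    unbounded function of Z, while the hypotheses speak of unitaries only.
    Everything is measured in the seminorm ||A||^2 = Tr rho (A^t* A) ([nrm]);
    a unitary factor between two approximations does not affect it.

    From W to 2 Z. The hypothesis on Ot for products of two factors gives
    ||exp (i a W) - exp (2 i a Z)|| --> 0. So exp (2 i a Z) may replace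
    exp (i a W) at both ends of a product, and the law of 2 Z under rho, with
    weights [pr] and atoms [lw], converges to N(- s^2/2, s^2) in the sense of
    characteristic functions.

    Damping. The function f_d(x) = exp (x/2 - d x^2/2) lies between 0 and
    exp (x/2) and is an average of the characters exp (i a x) against a complex
    Gaussian kernel. Dominated convergence in a ([gavg_cvg]) therefore turns
    convergence of characteristic functions into convergence of expectations of
    f_d. With w for 2 Z, the expectation of f_d(w)^2 tends to a number which is
    close to 1 for small d ([gaussian_moment_cvg], [Flim_lower]). The total mass
    E exp w = ||B||^2 is asymptotically at most 1, because ||L|| <= 1 and
    ||O|| --> 0. Hence the mass tends to 1, and the part of it lost by damping is
    small ([tail_small]). This yields contiguity, and also that
    ||B - f_d(2 Z)|| is small, since (1 - u)^2 <= 1 - u^2 for 0 <= u <= 1.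

    The limit. By the Gaussian convergence hypothesis ([gauss_qchar_flank]),
    Tr rho (exp (2 i a Z) Pi exp (2 i b Z)) and
    G exp (- a al - b conj al) E exp (i (a + b) w) have the same limit, where G is
    the quasi-characteristic function of X under rho and al pairs xi with kappa.
    Averaging both sides over a and b ([double_average]) shows that
    Tr rho (f_d(2 Z) Pi f_d(2 Z)) is asymptotically
    G E [f_d(w + i al) f_d(w + i conj al)]; for small d this is close to
    G exp (i Re al) E exp w ([gshift_mean]), hence to G exp (i Re al). The factor
    exp (i Re al) is the shift of the mean by Re kappa.

    The choice of the likelihood ratio is immaterial because L rho is
    determined by rho and sigma ([sqrt_lr_unique]). *)

(** * Complex numbers and limits *)

Section Complex.
Variable R : realType.
Implicit Types z u : R[i].
Local Notation Re := (@complex.Re R).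
Local Notation Im := (@complex.Im R).

Lemma normc_norm z : `|z| = (normc z)%:C.
Proof. by case: z => a b; rewrite normc_def. Qed.

Lemma normc_ge0 z : 0 <= normc z.
Proof. by case: z => a b /=; apply: sqrtr_ge0. Qed.

Lemma normc_real (x : R) : normc x%:C = `|x|.
Proof. by rewrite /= expr0n /= addr0 sqrtr_sqr. Qed.

Lemma normc_distC z u : normc (z - u) = normc (u - z).
Proof. by rewrite -normcN opprB. Qed.

Lemma sqr_normcE z : normc z ^+ 2 = Re z ^+ 2 + Im z ^+ 2.
Proof. by case: z => a b /=; rewrite sqr_sqrtr // addr_ge0 // sqr_ge0. Qed.

Lemma Re_le_normc z : `|Re z| <= normc z.
Proof.
rewrite -(ler_pXn2r (n := 2)) ?nnegrE ?normc_ge0 // sqr_normcE real_normK ?num_real //.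
by rewrite lerDl sqr_ge0.
Qed.

Lemma Im_le_normc z : `|Im z| <= normc z.
Proof.
rewrite -(ler_pXn2r (n := 2)) ?nnegrE ?normc_ge0 // sqr_normcE real_normK ?num_real //.
by rewrite lerDr sqr_ge0.
Qed.

Lemma normc_le_ReIm z : normc z <= `|Re z| + `|Im z|.
Proof.
rewrite -(ler_pXn2r (n := 2)) ?nnegrE ?normc_ge0 ?addr_ge0 // sqr_normcE.
rewrite -[X in X + _]real_normK ?num_real // -[X in _ + X]real_normK ?num_real //.
have := normr_ge0 (Re z); have := normr_ge0 (Im z); nra.
Qed.

Lemma normc_sum (I : Type) (r : seq I) (P : pred I) (F : I -> R[i]) :
  normc (\sum_(i <- r | P i) F i) <= \sum_(i <- r | P i) normc (F i).
Proof.
apply: (big_ind2 (fun x y => normc x <= y)) => //; first by rewrite normc0.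
by move=> x1 x2 y1 y2 h1 h2; apply: le_trans (le_normcD _ _) (lerD h1 h2).
Qed.

Lemma cexpD z u : cexp (z + u) = cexp z * cexp u.
Proof.
case: z u => a b [c d]; rewrite /cexp /= expRD cosD sinD.
by apply/eqP; rewrite eq_complex /=; apply/andP; split; apply/eqP; ring.
Qed.

Lemma cexp0 : cexp 0 = 1 :> R[i].
Proof. by rewrite /cexp /= expR0 cos0 sin0 mul1r. Qed.

Lemma cexp_real (x : R) : cexp x%:C = (expR x)%:C.
Proof. by rewrite /cexp /= cos0 sin0 mulr1. Qed.

Lemma conj_cexp z : (cexp z)^* = cexp z^*.
Proof.
case: z => a b; rewrite /cexp /= cosN sinN.
by apply/eqP; rewrite eq_complex /=; apply/andP; split; apply/eqP; ring.
Qed.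

Lemma normc_cexp z : normc (cexp z) = expR (Re z).
Proof.
rewrite /cexp normcM normc_real ger0_norm ?expR_ge0 //=.
by rewrite cos2Dsin2 sqrtr1 mulr1.
Qed.

Lemma ReM (z w : R[i]) : Re (z * w) = Re z * Re w - Im z * Im w.
Proof. by case: z w => a b [c d]. Qed.

Lemma ImM (z w : R[i]) : Im (z * w) = Re z * Im w + Im z * Re w.
Proof. by case: z w => a b [c d]. Qed.

Lemma ReD (z w : R[i]) : Re (z + w) = Re z + Re w.
Proof. by case: z w => a b [c d]. Qed.

Lemma ImD (z w : R[i]) : Im (z + w) = Im z + Im w.
Proof. by case: z w => a b [c d]. Qed.

Lemma sqr_imag (y : R) : (0 +i* y) ^+ 2 = (- y ^+ 2)%:C :> R[i].
Proof.
rewrite expr2; apply/eqP.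
by rewrite eq_complex /= !mul0r !mulr0 addr0 sub0r expr2 !eqxx.
Qed.

Lemma imagD (x y : R) : (0 +i* x) + (0 +i* y) = 0 +i* (x + y) :> R[i].
Proof. by apply/eqP; rewrite eq_complex /= addr0 !eqxx. Qed.

Lemma imagM (x a : R) : (0 +i* x) * a%:C = 0 +i* (x * a) :> R[i].
Proof. by apply/eqP; rewrite eq_complex /= !mul0r mulr0 subrr add0r !eqxx. Qed.

Lemma real_div (x y : R) : x%:C / y%:C = (x / y)%:C :> R[i].
Proof. by rewrite -fmorphV -rmorphM. Qed.

Definition cis (x : R) : R[i] := cexp (0 +i* x).

Lemma cis_conj x : (cis x)^* = cis (- x).
Proof. by rewrite /cis conj_cexp. Qed.

Lemma cisD x y : cis (x + y) = cis x * cis y.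
Proof. by rewrite /cis -cexpD; congr cexp; apply/eqP; rewrite eq_complex /= addr0 !eqxx. Qed.

Lemma cis0 : cis 0 = 1.
Proof. exact: cexp0. Qed.

Lemma normc_cis x : normc (cis x) = 1.
Proof. by rewrite /cis normc_cexp /= expR0. Qed.

Lemma cisVK x : cis x * cis (- x) = 1.
Proof. by rewrite -cisD subrr cis0. Qed.

End Complex.

Section ComplexLimits.
Variable R : realType.
Implicit Types (f g : nat -> R[i]) (l m : R[i]).
Local Notation Re := (@complex.Re R).
Local Notation Im := (@complex.Im R).

(** Convergence through the real sequence of distances, so that squeeze
    arguments take place in R; [ctendsP] is the link to the topology of R[i]^o. *)
Definition ctends (f : nat -> R[i]) (l : R[i]) : Prop :=
  (fun n => normc (f n - l)) @ \oo --> (0 : R).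

Lemma ctendsP f l : f @ \oo --> (l : R[i]^o) <-> ctends f l.
Proof.
split.
- move=> /(@cvgrPdist_lt _ R[i]^o) h; apply/cvgrPdist_lt => e e0.
  have /h : 0 < e%:C by rewrite ltcR.
  apply: filterS => n; rewrite /= normc_norm ltcR normc_distC sub0r normrN.
  by rewrite ger0_norm // normc_ge0.
- move=> /cvgrPdist_lt h; apply/(@cvgrPdist_lt _ R[i]^o) => e e0.
  have [/eqP e_im e_re] : Im e == 0 /\ 0 < Re e.
    by move: e0; rewrite ltcE /= => /andP[].
  have := h _ e_re; apply: filterS => n /=.
  rewrite normc_norm sub0r normrN ger0_norm ?normc_ge0 // normc_distC => hh.
  by rewrite ltcE /= e_im eqxx.
Qed.

Lemma ctends_ReIm (f : nat -> R[i]) l :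
  (fun n => Re (f n)) @ \oo --> Re l -> (fun n => Im (f n)) @ \oo --> Im l ->
  ctends f l.
Proof.
move=> h1 h2; rewrite /ctends.
have h : (fun n => `|Re (f n) - Re l| + `|Im (f n) - Im l|) @ \oo --> (0 : R).
  rewrite -[X in _ --> X]addr0; apply: cvgD.
    by rewrite -(normr0 R) -(subrr (Re l)); apply: cvg_norm; apply: cvgB => //; exact: cvg_cst.
  by rewrite -(normr0 R) -(subrr (Im l)); apply: cvg_norm; apply: cvgB => //; exact: cvg_cst.
apply: squeeze_cvgr (cvg_cst 0) h; apply: nearW => n; rewrite normc_ge0 /=.
by apply: le_trans (normc_le_ReIm _) _; case: (f n) (l) => a b [c d].
Qed.

Lemma Rcvg_dist (f : nat -> R) (l : R) :
  (fun n => `|f n - l|) @ \oo --> (0 : R) -> f @ \oo --> l.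
Proof.
move=> /cvgrPdist_lt h; apply/cvgrPdist_lt => e e0.
by have := h _ e0; apply: filterS => n /=; rewrite sub0r normrN normr_id distrC.
Qed.

Lemma ctends_Re (f : nat -> R[i]) l : ctends f l -> (fun n => Re (f n)) @ \oo --> Re l.
Proof.
move=> h; apply: Rcvg_dist.
apply: squeeze_cvgr (cvg_cst 0) h; apply: nearW => n; rewrite normr_ge0 /=.
by apply: le_trans (Re_le_normc _); case: (f n) (l) => a b [c d].
Qed.

Lemma ctends_Im (f : nat -> R[i]) l : ctends f l -> (fun n => Im (f n)) @ \oo --> Im l.
Proof.
move=> h; apply: Rcvg_dist.
apply: squeeze_cvgr (cvg_cst 0) h; apply: nearW => n; rewrite normr_ge0 /=.
by apply: le_trans (Im_le_normc _); case: (f n) (l) => a b [c d].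
Qed.

Lemma ctends_ext f g l : f =1 g -> ctends f l -> ctends g l.
Proof. by move=> /funext ->. Qed.

Lemma ctends_squeeze f l (e : nat -> R) :
  (\forall n \near \oo, normc (f n - l) <= e n) -> e @ \oo --> (0 : R) -> ctends f l.
Proof.
move=> h he; apply: squeeze_cvgr (cvg_cst 0) he.
by apply: filterS h => n hn; rewrite normc_ge0.
Qed.

Lemma ctendsD f g l m : ctends f l -> ctends g m -> ctends (fun n => f n + g n) (l + m).
Proof.
move=> hf hg; apply: (@ctends_squeeze _ _ (fun n => normc (f n - l) + normc (g n - m))).
  by apply: nearW => n; rewrite opprD addrACA; exact: le_normcD.
by rewrite -[X in _ --> X]addr0; apply: cvgD.
Qed.

Lemma ctendsZ k f l : ctends f l -> ctends (fun n => k * f n) (k * l).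
Proof.
move=> hf; apply: (@ctends_squeeze _ _ (fun n => normc k * normc (f n - l))).
  by apply: nearW => n; rewrite -mulrBr normcM.
by rewrite -[X in _ --> X](mulr0 (normc k)); apply: cvgM => //; exact: cvg_cst.
Qed.

Lemma ctendsN f l : ctends f l -> ctends (fun n => - f n) (- l).
Proof.
by move=> /(ctendsZ (-1)); rewrite mulN1r; apply: ctends_ext => n; rewrite mulN1r.
Qed.

Lemma ctendsB f g l m : ctends f l -> ctends g m -> ctends (fun n => f n - g n) (l - m).
Proof. by move=> hf hg; apply: ctendsD => //; exact: ctendsN. Qed.

Lemma ctends_cst l : ctends (fun=> l) l.
Proof.
apply: (@ctends_squeeze _ _ (cst 0)); last exact: cvg_cst.
by apply: nearW => n; rewrite subrr normc0.
Qed.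

Lemma ctends_real (f : nat -> R) (l : R) : ctends (fun n => (f n)%:C) l%:C <-> f @ \oo --> l.
Proof.
split=> [h|h].
  apply: Rcvg_dist; apply: cvg_trans h; apply: near_eq_cvg; apply: nearW => n.
  by rewrite -rmorphB normc_real.
apply: (@ctends_squeeze _ _ (fun n => `|f n - l|)).
  by apply: nearW => n; rewrite -rmorphB normc_real.
by rewrite -(normr0 R) -(subrr l); apply: cvg_norm; apply: cvgB => //; exact: cvg_cst.
Qed.

Lemma ctends_unique f l l' : ctends f l -> ctends f l' -> l = l'.
Proof.
move=> h h'; apply/eqP; rewrite eq_complex; apply/andP; split; apply/eqP.
  exact: (cvg_unique _ (ctends_Re h) (ctends_Re h')).
exact: (cvg_unique _ (ctends_Im h) (ctends_Im h')).
Qed.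

Lemma cvg_sqr0 (f : nat -> R) :
  (fun n => f n ^+ 2) @ \oo --> (0 : R) -> f @ \oo --> (0 : R).
Proof.
move=> h; apply/cvgrPdist_lt => e e0.
have e2 : 0 < e ^+ 2 by rewrite exprn_gt0.
move/cvgrPdist_lt : h => /(_ _ e2); apply: filterS => n /=.
rewrite !sub0r !normrN normrX; apply: contraTT; rewrite -!leNgt => hn.
by rewrite ler_pXn2r // nnegrE ltW.
Qed.

End ComplexLimits.

(** * Gaussian integrals *)

Section Gauss.
Variable R : realType.
Notation mu := (@lebesgue_measure R).

Lemma Rdominated_cvg (f_ : nat -> R -> R) (f g : R -> R) :
  (forall n, measurable_fun setT (f_ n)) -> measurable_fun setT f ->
  (forall x, (fun n => f_ n x) @ \oo --> f x) ->
  mu.-integrable setT (EFin \o g) ->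
  (forall n x, `|f_ n x| <= g x) ->
  (fun n => (\int[mu]_x f_ n x)%R) @ \oo --> (\int[mu]_x f x)%R.
Proof.
move=> mf_ mf cf ig fg.
have [] := @dominated_convergence _ _ _ mu setT measurableT
  (fun n x => (f_ n x)%:E) (EFin \o f) (EFin \o g).
- by move=> n; apply/measurable_EFinP; exact: mf_.
- by apply/measurable_EFinP.
- by apply: aeW => x _ /=; apply: cvg_EFin; [exact: nearW | exact: cf].
- by [].
- by apply: aeW => x n _ /=; rewrite lee_fin.
- move=> i_f _ h; apply: fine_cvg; rewrite fineK; first exact: h.
  by apply: integrable_fin_num.
Qed.

Definition gexp (q x a : R) : R := expR (- (q * a ^+ 2 / 2) + x * a).

Lemma gexp_gt0 q x a : 0 < gexp q x a. Proof. exact: expR_gt0. Qed.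

Lemma gexp_ge0 q x a : 0 <= gexp q x a. Proof. exact: expR_ge0. Qed.

Lemma continuous_gexp q x : continuous (gexp q x).
Proof.
move=> a; apply: (cvg_comp _ expR); last exact: continuous_expR.
apply: cvgD; last by apply: cvgM; [exact: cvg_cst | exact: cvg_id].
apply: cvgN; apply: cvgM; last exact: cvg_cst.
apply: cvgM; [exact: cvg_cst | exact: sqr_continuous].
Qed.

(** The total mass of [gexp q x]; see [Rintegral_gexp]. *)
Definition gmass (q x : R) : R :=
  Num.sqrt (pi *+ 2 / q) * expR (x ^+ 2 / (q *+ 2)).

Lemma gexp_normal q x a : 0 < q ->
  gexp q x a = gmass q x * normal_pdf (x / q) (Num.sqrt q)^-1 a.
Proof.
move=> q0; have sq0 : (Num.sqrt q)^-1 != 0 by rewrite invr_eq0 sqrtr_eq0 -ltNge.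
rewrite normal_pdfE // /normal_peak /normal_fun exprVn sqr_sqrtr ?ltW //.
rewrite /gmass.
have -> : q^-1 * pi *+ 2 = pi *+ 2 / q by rewrite mulrnAl [q^-1 * pi]mulrC.
set s := Num.sqrt _.
have s0 : s != 0 by rewrite sqrtr_eq0 -ltNge divr_gt0 // mulrn_wgt0 // pi_gt0.
rewrite mulrACA divff // mul1r -expRD /gexp; congr expR.
by field; rewrite ?gt_eqF.
Qed.

Lemma integrable_gexp q x : 0 < q -> mu.-integrable setT (EFin \o gexp q x).
Proof.
move=> q0.
have := @integrable_normal_pdf R (x / q) (Num.sqrt q)^-1.
move=> /(integrableZl measurableT (gmass q x)).
apply: eq_integrable => // a _ /=.
by rewrite gexp_normal // EFinM.
Qed.

Lemma Rintegral_gexp q x : 0 < q -> (\int[mu]_a gexp q x a)%R = gmass q x.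
Proof.
move=> q0.
under eq_Rintegral do rewrite gexp_normal //.
rewrite RintegralZl //; last exact: integrable_normal_pdf.
by rewrite /Rintegral integral_normal_pdf /= mulr1.
Qed.

Lemma integrable_dom (f g : R -> R) : measurable_fun setT f ->
  mu.-integrable setT (EFin \o g) -> (forall x, `|f x| <= g x) ->
  mu.-integrable setT (EFin \o f).
Proof.
move=> mf ig fg; apply: le_integrable ig => //; first exact/measurable_EFinP.
move=> x _ /=; rewrite lee_fin (le_trans (fg x)) // ler_norm //.
Qed.

Lemma integrableDR (f g : R -> R) :
  mu.-integrable setT (EFin \o f) -> mu.-integrable setT (EFin \o g) ->
  mu.-integrable setT (EFin \o (fun x => f x + g x)).
Proof. by move=> hf hg; have := integrableD measurableT hf hg. Qed.

Lemma integrableZR (k : R) (f : R -> R) :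
  mu.-integrable setT (EFin \o f) ->
  mu.-integrable setT (EFin \o (fun x => k * f x)).
Proof. by move=> hf; have := integrableZl measurableT k hf. Qed.

Lemma expR_abs_le (D a : R) : expR (D * `|a|) <= expR (D * a) + expR (- D * a).
Proof.
have [a0|a0] := lerP 0 a; first by rewrite ger0_norm // lerDl expR_ge0.
by rewrite ltr0_norm // mulrN mulNr lerDr expR_ge0.
Qed.

(** Integrands of exponential growth against a Gaussian weight are dominated by
    two integrable Gaussian weights. *)
Lemma gexp_abs_le q x D a :
  expR (D * `|a|) * gexp q x a <= gexp q (x + D) a + gexp q (x - D) a.
Proof.
have := expR_abs_le D a; move=> /(ler_wpM2r (ltW (gexp_gt0 q x a))).
rewrite mulrDl /gexp -!expRD => h; apply: le_trans h _.
by rewrite le_eqVlt; apply/orP; left; apply/eqP; congr (expR _ + expR _); ring.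
Qed.

End Gauss.

Section GaussDer.
Variable R : realType.
Notation mu := (@lebesgue_measure R).

(** The fundamental theorem of calculus on [-n, n] leaves boundary terms that
    vanish as n grows; dominated convergence passes to the whole line. *)
Lemma Rintegral_derive_eq0 (G G' : R -> R) :
  continuous G' -> (forall a, is_derive a (1 : R) G (G' a)) ->
  mu.-integrable setT (EFin \o G') ->
  (fun n : nat => G n%:R) @ \oo --> (0 : R) ->
  (fun n : nat => G (- n%:R)) @ \oo --> (0 : R) ->
  (\int[mu]_a G' a)%R = 0.
Proof.
move=> cG' dG iG' Gp Gm.
pose D (n : nat) : set R := `[- n.+1%:R, n.+1%:R]%classic.
have mG' : measurable_fun setT G' by apply: continuous_measurable_fun.
have mD n : measurable (D n) by exact: measurable_itv.
have intD n : (\int[mu]_a (G' \_ (D n)) a)%R = G n.+1%:R - G (- n.+1%:R).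
  rewrite -Rintegral_mkcond /Rintegral (@continuous_FTC2 _ G' G) //.
  - by apply: (@lt_trans _ _ 0); rewrite ?oppr_lt0 ltr0Sn.
  - exact: continuous_subspaceT.
  - have cG : continuous G.
      move=> a; apply: differentiable_continuous; apply/derivable1_diffP.
      by have [] := dG a.
    split.
    + by move=> a _; have [] := dG a.
    + by apply: cvg_at_right_filter; exact: cG.
    + by apply: cvg_at_left_filter; exact: cG.
  - by move=> a _; rewrite derive1E; apply: derive_val.
have h1 : (fun n => (\int[mu]_a (G' \_ (D n)) a)%R) @ \oo --> (\int[mu]_a G' a)%R.
  apply: (@Rdominated_cvg R _ _ (fun a => `|G' a|)) => //.
  - move=> n; apply/(measurable_restrictT _ (mD n)); exact: measurable_funTS.
  - move=> a; apply: cvg_near_cst.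
    near=> n; rewrite patchE ifT //; apply/mem_set; rewrite /D /= in_itv /= -ler_norml.
    apply: ltW; apply: (lt_trans (archi_boundP _)) => //.
    rewrite ltr_nat ltnS; near: n; exact: nbhs_infty_ge.
  - by have := integrable_abse iG'; apply: eq_integrable.
  - move=> n a; rewrite patchE; case: ifP => // _; rewrite ?normr0 ?normr_ge0 //.
have h2 : (fun n => (\int[mu]_a (G' \_ (D n)) a)%R) @ \oo --> (0 : R).
  rewrite (_ : (fun _ => _) = (fun n : nat => G n.+1%:R - G (- n.+1%:R)));
    last by apply/funext.
  rewrite -[X in _ --> X](subrr 0); apply: cvgB.
    by rewrite (cvg_shiftS (fun n : nat => G n%:R)).
  by rewrite (cvg_shiftS (fun n : nat => G (- n%:R))).
exact: (cvg_unique _ h1 h2).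
Unshelve. all: by end_near. Qed.

(** Complete the square in q |a| - (|x| + 1). *)
Lemma gexp_decay (q x : R) : 0 < q -> forall a,
  gexp q x a <= expR ((`|x| + 1) ^+ 2 / (q *+ 2)) * expR (- `|a|).
Proof.
move=> q0 a; rewrite -expRD ler_expR -subr_ge0.
have -> : (`|x| + 1) ^+ 2 / (q *+ 2) - `|a| - (- (q * a ^+ 2 / 2) + x * a)
  = (q * `|a| - (`|x| + 1)) ^+ 2 / (q *+ 2) + (`|x| * `|a| - x * a).
  rewrite -[in LHS](real_normK (num_real a)).
  by field; rewrite gt_eqF.
rewrite addr_ge0 //; first by rewrite divr_ge0 ?sqr_ge0 // mulrn_wge0 // ltW.
by rewrite subr_ge0 -normrM ler_norm.
Qed.

Lemma gexp_cvg0 (q x : R) (sg : bool) : 0 < q ->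
  (fun n : nat => gexp q x ((-1) ^+ sg * n%:R)) @ \oo --> (0 : R).
Proof.
move=> q0.
apply: (@squeeze_cvgr _ _ _ _ (cst 0)
  (fun n : nat => expR ((`|x| + 1) ^+ 2 / (q *+ 2)) * expR (- n%:R))).
- apply: nearW => n; rewrite gexp_ge0 //=.
  apply: le_trans (gexp_decay _ q0 _) _.
  by rewrite normrM normrX normrN1 expr1n mul1r ger0_norm.
- exact: cvg_cst.
- rewrite -[X in _ --> X](mulr0 (expR ((`|x| + 1) ^+ 2 / (q *+ 2)))).
  apply: cvgM; first exact: cvg_cst.
  apply: (cvg_comp (fun n : nat => n%:R) (fun x : R => expR (- x))); last exact: cvgr_expR.
  exact: cvgr_idn.
Qed.

Variables (q x c : R).
Hypothesis q0 : 0 < q.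
Let m := x / q.

Lemma is_derive_gexp a :
  is_derive a (1 : R) (gexp q x) (- (q * (a - m)) * gexp q x a).
Proof.
rewrite /gexp.
apply: trigger_derive.
rewrite /m /GRing.scale /=; set e := expR _.
by field; rewrite gt_eqF.
Qed.

Let th y a := y * (a - m) + c.

Lemma is_derive_sin_th y a :
  is_derive a (1 : R) (fun a => sin (th y a)) (y * cos (th y a)).
Proof. by apply: trigger_derive; rewrite /GRing.scale /=; ring. Qed.

Lemma is_derive_cos_th_y y a :
  is_derive y (1 : R) (fun y => cos (th y a)) (- ((a - m) * sin (th y a))).
Proof. by apply: trigger_derive; rewrite /GRing.scale /=; ring. Qed.

Lemma continuous_th y : continuous (th y).
Proof.
move=> a; apply: cvgD; last exact: cvg_cst.
by apply: cvgM; [exact: cvg_cst|apply: cvgB; [exact: cvg_id|exact: cvg_cst]].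
Qed.

Lemma continuous_cos_th y : continuous (fun a => cos (th y a)).
Proof. by move=> a; apply: (cvg_comp _ _ (@continuous_th y a)); apply: continuous_cos. Qed.

Lemma continuous_sin_th y : continuous (fun a => sin (th y a)).
Proof. by move=> a; apply: (cvg_comp _ _ (@continuous_th y a)); apply: continuous_sin. Qed.

Lemma continuousMR (f g : R -> R) :
  continuous f -> continuous g -> continuous (fun a => f a * g a).
Proof. by move=> cf cg a; apply: cvgM; [exact: cf|exact: cg]. Qed.

Lemma integrable_gexp_le (f : R -> R) D C : continuous f ->
  (forall a, `|f a| <= C * expR (D * `|a|)) ->
  mu.-integrable setT (EFin \o (fun a => gexp q x a * f a)).
Proof.
move=> cf fC.
apply: (@integrable_dom _ _ (fun a => C * (gexp q (x + D) a + gexp q (x - D) a))).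
- by apply: continuous_measurable_fun; apply: continuousMR => //; exact: continuous_gexp.
- by apply: integrableZR; apply: integrableDR; exact: integrable_gexp.
- move=> a; rewrite normrM ger0_norm ?gexp_ge0 //.
  have C0 : 0 <= C.
    have := fC 0; rewrite normr0 mulr0 expR0 mulr1; apply: le_trans; exact: normr_ge0.
  apply: (le_trans (ler_wpM2l (gexp_ge0 q x a) (fC a))).
  rewrite mulrCA ler_wpM2l // mulrC; exact: gexp_abs_le.
Qed.

Lemma subm_le a : `|a - m| <= expR `|m| * expR (1 * `|a|).
Proof.
rewrite mul1r -expRD; apply: (le_trans (ler_normB _ _)).
rewrite addrC; apply: le_trans (expR_ge1Dx _).
by rewrite lerDr.
Qed.

Lemma continuous_subm : continuous (fun a => a - m).
Proof. by move=> a; apply: cvgB; [exact: cvg_id|exact: cvg_cst]. Qed.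

Let F y := (\int[mu]_a (gexp q x a * cos (th y a)))%R.

Lemma integrable_gcos y : mu.-integrable setT (EFin \o (fun a => gexp q x a * cos (th y a))).
Proof.
apply: (@integrable_gexp_le _ 0 1); first exact: continuous_cos_th.
by move=> a; rewrite mul0r expR0 mulr1 cos_max.
Qed.

Lemma integrable_gsubsin y :
  mu.-integrable setT (EFin \o (fun a => gexp q x a * ((a - m) * sin (th y a)))).
Proof.
apply: (@integrable_gexp_le _ 1 (expR `|m|)).
  by apply: continuousMR; [exact: continuous_subm|exact: continuous_sin_th].
move=> a; rewrite normrM; apply: le_trans (subm_le a).
by rewrite ler_piMr // sin_max.
Qed.

(** Integration by parts: up to the factor - q, the function
    (a - m) gexp q x a is the derivative of [gexp q x]. *)
Lemma gcos_by_parts y :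
  (\int[mu]_a (gexp q x a * ((a - m) * sin (th y a))))%R = y / q * F y.
Proof.
pose G' := (fun a => (- q) * (gexp q x a * ((a - m) * sin (th y a))) +
   y * (gexp q x a * cos (th y a))).
have bnd a : `|gexp q x a * sin (th y a)| <= gexp q x a.
  by rewrite normrM ger0_norm ?gexp_ge0 // ler_piMr ?gexp_ge0 // sin_max.
have cv0 (sg : bool) :
    (fun n : nat => gexp q x ((-1) ^+ sg * n%:R) * sin (th y ((-1) ^+ sg * n%:R)))
      @ \oo --> (0 : R).
  apply/norm_cvg0P; apply: (@squeeze_cvgr _ _ _ _ (cst 0)
    (fun n : nat => gexp q x ((-1) ^+ sg * n%:R))).
  - by apply: nearW => n /=; rewrite normr_ge0 bnd.
  - exact: cvg_cst.
  - exact: gexp_cvg0.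
have : (\int[mu]_a G' a)%R = 0.
  apply: (@Rintegral_derive_eq0 (fun a => gexp q x a * sin (th y a))).
  - move=> a; apply: cvgD; apply: cvgM; try exact: cvg_cst.
      apply: continuousMR; first exact: continuous_gexp.
      by apply: continuousMR; [exact: continuous_subm|exact: continuous_sin_th].
    by apply: continuousMR; [exact: continuous_gexp|exact: continuous_cos_th].
  - move=> a.
    have := @is_deriveM _ _ _ _ _ _ _ _ (is_derive_gexp a) (is_derive_sin_th y a).
    by move=> dd; apply: (is_derive_eq dd); rewrite /G' /GRing.scale /=; ring.
  - apply: integrableDR; apply: integrableZR; first exact: integrable_gsubsin.
    exact: integrable_gcos.
  - by have := cv0 false; under eq_fun do rewrite expr0 mul1r.
  - by have := cv0 true; under eq_fun do rewrite expr1 mulN1r.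
rewrite RintegralD //; first last.
- by apply: integrableZR; exact: integrable_gcos.
- by apply: integrableZR; exact: integrable_gsubsin.
rewrite !RintegralZl //; [|exact: integrable_gcos|exact: integrable_gsubsin].
rewrite -/(F y) => h.
have qn : q != 0 by rewrite gt_eqF.
apply: (mulfI qn); rewrite mulrA mulrCA divff // mulr1.
by apply/eqP; rewrite -subr_eq0 -oppr_eq0 opprB addrC -mulNr h.
Qed.

(** Differentiation under the integral sign, then [gcos_by_parts]: the integral
    solves the linear equation F' = - (y / q) F. *)
Lemma is_derive_F y : is_derive y (1 : R) F (- (y / q * F y)).
Proof.
pose f y a := gexp q x a * cos (th y a).
have df y' a : is_derive y' (1 : R) (f ^~ a) (- (gexp q x a * ((a - m) * sin (th y' a)))).
  have := @is_deriveZ _ _ _ _ (gexp q x a) _ _ _ (is_derive_cos_th_y y' a).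
  by move=> dd; apply: (is_derive_eq dd); rewrite /GRing.scale /=; ring.
have Iy : y \in `](y - 1), (y + 1)[ by rewrite in_itv /= ltrBlDr ltrDl ltr01.
pose G a := gexp q x a * `|a - m|.
have G0 a : 0 <= G a by rewrite mulr_ge0 // gexp_ge0.
have iG : mu.-integrable setT (EFin \o G).
  apply: (@integrable_gexp_le _ 1 (expR `|m|)).
    move=> a; apply: (cvg_comp _ _ (@continuous_subm a)); exact: norm_continuous.
  by move=> a; rewrite normr_id subm_le.
have dE y' a : partial1of2 f y' a = - (gexp q x a * ((a - m) * sin (th y' a))).
  by rewrite partial1of2E; apply: derive_val.
have i1 : forall y', `](y - 1), (y + 1)[%classic y' ->
    mu.-integrable setT (EFin \o f y').
  by move=> y' _; exact: integrable_gcos.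
have i2 : forall y' a, `](y - 1), (y + 1)[%classic y' -> setT a ->
    derivable (f ^~ a) y' 1.
  by move=> y' a _ _; have [] := df y' a.
have i3 : forall y' a, `](y - 1), (y + 1)[%classic y' -> setT a ->
    `|partial1of2 f y' a| <= G a.
  move=> y' a _ _; rewrite dE normrN normrM ger0_norm ?gexp_ge0 //.
  by rewrite ler_wpM2l ?gexp_ge0 // normrM ler_piMr // sin_max.
have dF := @derivable_under_integral _ _ _ mu f setT measurableT y _ _
  Iy i1 i2 G G0 iG i3.
have F' := @differentiation_under_integral _ _ _ mu f setT measurableT y _ _
  Iy i1 i2 G G0 iG i3.
split; first exact: dF.
rewrite -derive1E F'.
under eq_Rintegral do rewrite dE -mulN1r.
by rewrite RintegralZl // ?gcos_by_parts ?mulN1r //; exact: integrable_gsubsin.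
Qed.

(** By [is_derive_F] the product F y * exp (y^2 / (2 q)) is constant. The free
    phase c yields the cosine and the sine integral at once. *)
Lemma gcos_integral y :
  (\int[mu]_a (gexp q x a * cos (y * (a - m) + c)))%R =
  expR (- (y ^+ 2 / (q *+ 2))) * cos c * gmass q x.
Proof.
pose K y := F y * expR (y ^+ 2 / (q *+ 2)).
have dK z : is_derive z (1 : R) K 0.
  have dE : is_derive z (1 : R) (fun y => expR (y ^+ 2 / (q *+ 2)))
      (z / q * expR (z ^+ 2 / (q *+ 2))).
    apply: trigger_derive; rewrite /GRing.scale /=; set e := expR _.
    by field; rewrite gt_eqF.
  have := @is_deriveM _ _ _ _ _ _ _ _ (is_derive_F z) dE.
  by move=> dd; apply: (is_derive_eq dd); rewrite /GRing.scale /=; ring.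
have := is_derive_0_is_cst y 0 dK.
rewrite /K expr0n /= mul0r expR0 mulr1.
have -> : F 0 = cos c * gmass q x.
  rewrite /F /th; under eq_Rintegral do rewrite mul0r add0r mulrC.
  by rewrite RintegralZl // ?Rintegral_gexp //; exact: integrable_gexp.
by move=> h; rewrite -mulrA -h mulrC -mulrA -expRD subrr expR0 mulr1.
Qed.

End GaussDer.

(** * Integrals of complex-valued functions *)

Section CIntegral.
Variable R : realType.
Notation mu := (@lebesgue_measure R).
Implicit Types F G : R -> R[i].

Local Notation Re := (@complex.Re R).
Local Notation Im := (@complex.Im R).

Definition Cint F : R[i] :=
  (\int[mu]_a Re (F a))%R +i* (\int[mu]_a Im (F a))%R.

Definition Cintegrable F : Prop :=
  mu.-integrable setT (EFin \o (fun a => Re (F a))) /\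
  mu.-integrable setT (EFin \o (fun a => Im (F a))).

Lemma eq_Cint F G : F =1 G -> Cint F = Cint G.
Proof. by move=> FG; congr (_ +i* _); apply: eq_Rintegral => a _; rewrite FG. Qed.

Lemma eq_Cintegrable F G : F =1 G -> Cintegrable F -> Cintegrable G.
Proof. by move=> /funext ->. Qed.

Lemma CintegrableD F G : Cintegrable F -> Cintegrable G ->
  Cintegrable (fun a => F a + G a).
Proof.
move=> [F1 F2] [G1 G2]; split.
  by have := integrableDR F1 G1; apply: eq_integrable => // a _ /=; rewrite ReD.
by have := integrableDR F2 G2; apply: eq_integrable => // a _ /=; rewrite ImD.
Qed.

Lemma CintD F G : Cintegrable F -> Cintegrable G ->
  Cint (fun a => F a + G a) = Cint F + Cint G.
Proof.
move=> [F1 F2] [G1 G2]; apply/eqP; rewrite eq_complex /=.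
under eq_Rintegral do rewrite ReD.
under [X in _ && (X == _)]eq_Rintegral do rewrite ImD.
by rewrite !RintegralD // !eqxx.
Qed.

Lemma CintegrableZ (k : R[i]) F : Cintegrable F -> Cintegrable (fun a => k * F a).
Proof.
move=> [F1 F2]; split.
  have := integrableDR (integrableZR (Re k) F1) (integrableZR (- Im k) F2).
  by apply: eq_integrable => // a _ /=; rewrite ReM mulNr.
have := integrableDR (integrableZR (Re k) F2) (integrableZR (Im k) F1).
by apply: eq_integrable => // a _ /=; rewrite ImM.
Qed.

Lemma CintZ (k : R[i]) F : Cintegrable F -> Cint (fun a => k * F a) = k * Cint F.
Proof.
move=> [F1 F2]; apply/eqP; rewrite eq_complex ReM ImM /=.
under eq_Rintegral do rewrite ReM -mulNr.
under [X in _ && (X == _)]eq_Rintegral do rewrite ImM.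
rewrite !RintegralD // ?RintegralZl // ?mulNr ?eqxx //; exact: integrableZR.
Qed.

Lemma Cint0 : Cint (fun=> 0) = 0.
Proof. by apply/eqP; rewrite eq_complex /= !Rintegral_cst //= !mul0r eqxx. Qed.

Lemma Cintegrable0 : Cintegrable (fun=> 0).
Proof. by split; apply: (@eq_integrable _ _ _ _ _ _ (cst 0%E)) => //; exact: integrable0. Qed.

Lemma Cint_sum (I : Type) (r : seq I) (c : I -> R[i]) (F : I -> R -> R[i]) :
  (forall j, Cintegrable (F j)) ->
  Cintegrable (fun a => \sum_(j <- r) c j * F j a) /\
  Cint (fun a => \sum_(j <- r) c j * F j a) = \sum_(j <- r) c j * Cint (F j).
Proof.
move=> iF; elim: r => [|j r [IH1 IH2]].
  under eq_fun do rewrite big_nil.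
  by rewrite big_nil; split; [exact: Cintegrable0 | exact: Cint0].
under eq_fun do rewrite big_cons.
rewrite big_cons CintD //; last exact: CintegrableZ.
by rewrite CintZ // IH2; split => //; apply: CintegrableD => //; exact: CintegrableZ.
Qed.

Lemma normc_Cint F (G : R -> R) : Cintegrable F -> mu.-integrable setT (EFin \o G) ->
  (forall a, normc (F a) <= G a) -> normc (Cint F) <= 2 * (\int[mu]_a G a)%R.
Proof.
move=> [F1 F2] iG FG; apply: le_trans (normc_le_ReIm _) _.
rewrite mulr_natl mulr2n /=; apply: lerD.
  apply: le_trans (le_normr_Rintegral measurableT F1) _.
  apply: le_Rintegral => //; first exact: integrable_norm.
  by move=> a _; apply: le_trans (FG a); exact: Re_le_normc.
apply: le_trans (le_normr_Rintegral measurableT F2) _.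
apply: le_Rintegral => //; first exact: integrable_norm.
by move=> a _; apply: le_trans (FG a); exact: Im_le_normc.
Qed.

Lemma Cint_dominated (F_ : nat -> R -> R[i]) F (G : R -> R) :
  (forall n, Cintegrable (F_ n)) -> Cintegrable F ->
  (forall a, ctends (fun n => F_ n a) (F a)) ->
  mu.-integrable setT (EFin \o G) -> (forall n a, normc (F_ n a) <= G a) ->
  ctends (fun n => Cint (F_ n)) (Cint F).
Proof.
move=> iF_ [iF1 iF2] cF iG FG; apply: ctends_ReIm => /=.
  apply: (@Rdominated_cvg R _ _ G) => //.
  - by move=> n; have [/measurable_int/measurable_EFinP] := iF_ n.
  - by move/measurable_int/measurable_EFinP : iF1.
  - by move=> a; exact: ctends_Re.
  - by move=> n a; apply: le_trans (FG n a); exact: Re_le_normc.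
apply: (@Rdominated_cvg R _ _ G) => //.
- by move=> n; have [_ /measurable_int/measurable_EFinP] := iF_ n.
- by move/measurable_int/measurable_EFinP : iF2.
- by move=> a; exact: ctends_Im.
- by move=> n a; apply: le_trans (FG n a); exact: Im_le_normc.
Qed.

(** Kernels exp (- q a^2 / 2 + z a). For q > 0 they are the averaging kernels;
    characteristic functions of normal laws, degenerate ones included, also
    have this form. *)
Definition cgauss (q : R) (z : R[i]) (a : R) : R[i] :=
  cexp (- (q * a ^+ 2 / 2)%:C + z * a%:C).

Lemma cgaussE q z a : cgauss q z a =
  (gexp q (Re z) a * cos (Im z * a)) +i* (gexp q (Re z) a * sin (Im z * a)).
Proof.
rewrite /cgauss /cexp /gexp; case: z => x y /=.
by apply/eqP; rewrite eq_complex /= !mulr0 !mul0r oppr0 !(subr0, addr0, add0r) !eqxx.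
Qed.

Lemma normc_cgauss q z a : normc (cgauss q z a) = gexp q (Re z) a.
Proof.
by rewrite /cgauss normc_cexp /gexp; congr expR; case: z => x y /=; rewrite mulr0 subr0.
Qed.

Lemma cgaussM q p z u a : cgauss p z a * cgauss q u a = cgauss (q + p) (z + u) a.
Proof.
rewrite /cgauss -cexpD; congr cexp.
apply/eqP; rewrite eq_complex; case: z u => x y [x' y'] /=.
by apply/andP; split; apply/eqP; ring.
Qed.

Lemma Cintegrable_cgauss q z : 0 < q -> Cintegrable (cgauss q z).
Proof.
have cE (y : R) : continuous ( *%R y ).
  by move=> a; apply: cvgM; [exact: cvg_cst|exact: cvg_id].
move=> q0; split.
  have := @integrable_gexp_le R q (Re z) q0 (fun a => cos (Im z * a)) 0 1.
  have h : continuous (fun a => cos (Im z * a)).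
    by move=> a; apply: (cvg_comp _ _ (cE (Im z) a)); exact: continuous_cos.
  move=> /(_ h) h'; have h2 a : `|cos (Im z * a)| <= 1 * expR (0 * `|a|).
    by rewrite mul0r expR0 mulr1 cos_max.
  by have := h' h2; apply: eq_integrable => // a _; rewrite /comp cgaussE.
have := @integrable_gexp_le R q (Re z) q0 (fun a => sin (Im z * a)) 0 1.
have h : continuous (fun a => sin (Im z * a)).
  by move=> a; apply: (cvg_comp _ _ (cE (Im z) a)); exact: continuous_sin.
move=> /(_ h) h'; have h2 a : `|sin (Im z * a)| <= 1 * expR (0 * `|a|).
  by rewrite mul0r expR0 mulr1 sin_max.
by have := h' h2; apply: eq_integrable => // a _; rewrite /comp cgaussE.
Qed.

Lemma Cint_cgauss q z : 0 < q ->
  Cint (cgauss q z) = (Num.sqrt (pi *+ 2 / q))%:C * cexp (z ^+ 2 / (q *+ 2)%:C).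
Proof.
move=> q0; case: z => x y.
have qn : q != 0 by rewrite gt_eqF.
rewrite /Cint.
under eq_Rintegral do rewrite cgaussE /=.
under [X in _ +i* X]eq_Rintegral do rewrite cgaussE /=.
have := @gcos_integral R q x (y * (x / q)) q0 y.
under eq_Rintegral do rewrite -mulrDr subrK.
move=> ->.
have := @gcos_integral R q x (y * (x / q) - pi / 2) q0 y.
under eq_Rintegral do rewrite addrA -mulrDr subrK cosBpihalf.
move=> ->; rewrite cosBpihalf /gmass.
have -> : (x +i* y) ^+ 2 / (q *+ 2)%:C =
    ((x ^+ 2 / (q *+ 2) - y ^+ 2 / (q *+ 2)) +i* (y * (x / q)))%C.
  rewrite expr2; apply/eqP; rewrite eq_complex /=; apply/andP; split; apply/eqP.
    by field; rewrite qn.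
  by field; rewrite qn.
rewrite /cexp /= expRD; set s := Num.sqrt _.
by apply/eqP; rewrite eq_complex /=; apply/andP; split; apply/eqP; ring.
Qed.

End CIntegral.

(** * Gaussian averages of exponential sums *)

Section GaussAverage.
Variable R : realType.
Notation mu := (@lebesgue_measure R).

Definition expsum (I : finType) (c zeta : I -> R[i]) (a : R) : R[i] :=
  \sum_j c j * cexp (zeta j * a%:C).

(** The Gaussian average of [expsum c zeta]: each exponential is replaced by its
    integral against [cgauss q u], up to the common factor sqrt (2 pi / q)
    ([Cint_expsum]). *)
Definition gavg (q : R) (u : R[i]) (I : finType) (c zeta : I -> R[i]) : R[i] :=
  \sum_j c j * cexp ((zeta j + u) ^+ 2 / (q *+ 2)%:C).

Lemma expsum_cgauss q u (I : finType) (c zeta : I -> R[i]) a :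
  expsum c zeta a * cgauss q u a = \sum_j c j * cgauss q (zeta j + u) a.
Proof.
rewrite /expsum mulr_suml; apply: eq_bigr => j _; rewrite -mulrA; congr (_ * _).
rewrite /cgauss -cexpD; congr cexp; rewrite mulrDl; ring.
Qed.

Lemma Cint_expsum q u (I : finType) (c zeta : I -> R[i]) : 0 < q ->
  Cintegrable (fun a => expsum c zeta a * cgauss q u a) /\
  Cint (fun a => expsum c zeta a * cgauss q u a) =
    (Num.sqrt (pi *+ 2 / q))%:C * gavg q u c zeta.
Proof.
move=> q0.
have [h1 h2] := @Cint_sum R I (index_enum I) c (fun j => cgauss q (zeta j + u))
  (fun j => Cintegrable_cgauss _ q0).
split.
  by apply: eq_Cintegrable h1 => a; rewrite expsum_cgauss.
rewrite (eq_Cint (expsum_cgauss q u c zeta)) h2 /gavg mulr_sumr.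
by apply: eq_bigr => j _; rewrite Cint_cgauss // mulrCA.
Qed.

Definition gdom (q D : R) (u : R[i]) (a : R) :=
  gexp q (complex.Re u + D) a + gexp q (complex.Re u - D) a.

Lemma integrable_gdom q D u : 0 < q -> mu.-integrable setT (EFin \o gdom q D u).
Proof. by move=> q0; apply: integrableDR; exact: integrable_gexp. Qed.

Lemma normc_expsum_cgauss q D u C (I : finType) (c zeta : I -> R[i]) a :
  normc (expsum c zeta a) <= C * expR (D * `|a|) ->
  normc (expsum c zeta a * cgauss q u a) <= C * gdom q D u a.
Proof.
move=> h; rewrite normcM normc_cgauss.
have C0 : 0 <= C.
  rewrite -(pmulr_lge0 _ (expR_gt0 (D * `|a|))); apply: le_trans h.
  exact: normc_ge0.
apply: (le_trans (ler_wpM2r (gexp_ge0 _ _ _) h)); rewrite -mulrA ler_wpM2l //.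
exact: gexp_abs_le.
Qed.

Lemma sqrt_mass_gt0 (q : R) : 0 < q -> 0 < Num.sqrt (pi *+ 2 / q).
Proof. by move=> q0; rewrite sqrtr_gt0 divr_gt0 // mulrn_wgt0 // pi_gt0. Qed.

(** The bound is linear in C and uniform over all sums, as iterated averages
    require. *)
Lemma gavg_bounded (q D : R) (u : R[i]) : 0 < q ->
  exists M : R, forall (C : R) (I : finType) (c zeta : I -> R[i]),
    (forall a, normc (expsum c zeta a) <= C * expR (D * `|a|)) ->
    normc (gavg q u c zeta) <= M * C.
Proof.
move=> q0; exists ((Num.sqrt (pi *+ 2 / q))^-1 * (2 * (\int[mu]_a gdom q D u a)%R)).
move=> C I c zeta h.
have [i1 i2] := Cint_expsum u c zeta q0.
have s0 := sqrt_mass_gt0 q0.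
have := normc_Cint i1 (integrableZR C (integrable_gdom D u q0))
  (fun a => normc_expsum_cgauss q u (h a)).
rewrite i2 normcM normc_real ger0_norm ?sqrtr_ge0 // RintegralZl //;
  last exact: integrable_gdom.
move=> h'; rewrite -mulrA ler_pdivlMl //; apply: le_trans h' _.
by rewrite le_eqVlt; apply/orP; left; apply/eqP; ring.
Qed.

(** Pointwise convergence of exponential sums of uniform exponential growth
    passes to their Gaussian averages, by dominated convergence in the
    frequency a. The limit k * cgauss p z is general enough for characteristic
    functions of normal laws (p > 0) and for the zero limit (k = 0). *)
Lemma gavg_cvg (q p : R) (u z k : R[i]) (C D : R) (I : nat -> finType)
    (c zeta : forall n, I n -> R[i]) :
  0 < q -> 0 <= p ->
  (forall n a, normc (expsum (c n) (zeta n) a) <= C * expR (D * `|a|)) ->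
  (forall a, ctends (fun n => expsum (c n) (zeta n) a) (k * cgauss p z a)) ->
  ctends (fun n => gavg q u (c n) (zeta n))
    (k * (Num.sqrt (q / (q + p)))%:C * cexp ((z + u) ^+ 2 / ((q + p) *+ 2)%:C)).
Proof.
move=> q0 p0 hb hc.
have qp0 : 0 < q + p by rewrite ltr_wpDr.
have s0 := sqrt_mass_gt0 q0.
have := @Cint_dominated R (fun n a => expsum (c n) (zeta n) a * cgauss q u a)
  (fun a => k * cgauss (q + p) (z + u) a) (fun a => C * gdom q D u a).
move=> /(_ _ _ _ _ _)/wrap [].
- by move=> n; have [] := Cint_expsum u (c n) (zeta n) q0.
- by apply: CintegrableZ; exact: Cintegrable_cgauss.
- move=> a; rewrite -cgaussM mulrA mulrC.
  by move: (hc a) => /(ctendsZ (cgauss q u a)); apply: ctends_ext => n; rewrite mulrC.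
- by apply: integrableZR; exact: integrable_gdom.
- by move=> n a; apply: normc_expsum_cgauss.
move=> /(ctendsZ (Num.sqrt (pi *+ 2 / q))^-1%:C).
have -> : (Num.sqrt (pi *+ 2 / q))^-1%:C * Cint (fun a => k * cgauss (q + p) (z + u) a) =
  (k * (Num.sqrt (q / (q + p)))%:C * cexp ((z + u) ^+ 2 / ((q + p) *+ 2)%:C)).
  rewrite CintZ; last exact: Cintegrable_cgauss.
  rewrite Cint_cgauss // mulrCA -mulrA; congr (_ * _); rewrite mulrA; congr (_ * _).
  have pq0 r : 0 < r -> 0 <= pi *+ 2 / r :> R.
    by move=> r0; rewrite divr_ge0 ?(ltW r0) // mulrn_wge0 // pi_ge0.
  rewrite -rmorphM /=; congr (_%:C); rewrite -sqrtrV ?pq0 // -sqrtrM ?invr_ge0 ?pq0 //.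
  congr (Num.sqrt _); have pi0 : pi != 0 :> R by rewrite gt_eqF // pi_gt0.
  move: (pi : R) pi0 => c0 c00; by field; rewrite c00 (gt_eqF q0) (gt_eqF qp0).
apply: ctends_ext => n.
have [_ ->] := Cint_expsum u (c n) (zeta n) q0.
by rewrite mulrA -rmorphM /= mulVf ?mul1r // gt_eqF.
Qed.

End GaussAverage.

(** * Adjoints and unitary diagonalisation *)

Section Adjoint.
Variable (C : numClosedFieldType).

Lemma ctmxM m n p (A : 'M[C]_(m, n)) (B : 'M[C]_(n, p)) : (A *m B)^t* = B^t* *m A^t*.
Proof. by rewrite trmx_mul map_mxM. Qed.

Lemma ctmxD m n (A B : 'M[C]_(m, n)) : (A + B)^t* = A^t* + B^t*.
Proof. by rewrite !raddfD. Qed.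

Lemma ctmxN m n (A : 'M[C]_(m, n)) : (- A)^t* = - A^t*.
Proof. by rewrite !raddfN. Qed.

Lemma ctmxB m n (A B : 'M[C]_(m, n)) : (A - B)^t* = A^t* - B^t*.
Proof. by rewrite ctmxD ctmxN. Qed.

Lemma ctmxZ m n (c : C) (A : 'M[C]_(m, n)) : (c *: A)^t* = c^* *: A^t*.
Proof. by rewrite linearZ /= map_mxZ. Qed.

Lemma ctmx1 n : (1%:M : 'M[C]_n)^t* = 1%:M.
Proof. by rewrite trmx1 map_mx1. Qed.

Lemma ctmx0 m n : (0 : 'M[C]_(m, n))^t* = 0.
Proof. by rewrite trmx0 map_mx0. Qed.

Lemma trace_adj n (A : 'M[C]_n) : \tr (A^t*) = (\tr A)^*.
Proof.
rewrite -map_trmx mxtrace_tr /mxtrace rmorph_sum.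
by apply: eq_bigr => i _; rewrite mxE.
Qed.

Lemma hermsymE n (A : 'M[C]_n) : A \is hermsymmx <-> A^t* = A.
Proof.
split=> [/is_hermitianmxP|]; first by rewrite expr0 scale1r => <-.
by move=> h; apply/is_hermitianmxP; rewrite expr0 scale1r h.
Qed.

Lemma unitaryVr n (U : 'M[C]_n) : U \is unitarymx -> U *m U^t* = 1%:M.
Proof. by move=> /unitarymxP. Qed.

Lemma unitaryVl n (U : 'M[C]_n) : U \is unitarymx -> U^t* *m U = 1%:M.
Proof. by move=> /unitarymxP; apply: mulmx1C. Qed.

Lemma unitary1 n : (1%:M : 'M[C]_n) \is unitarymx.
Proof. by apply/unitarymxP; rewrite ctmx1 mulmx1. Qed.

Lemma unitary_prod n r (F : 'I_r -> 'M[C]_n) : (forall t, F t \is unitarymx) ->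
  (\prod_t F t : 'M[C]_n) \is unitarymx.
Proof.
move=> h; apply: (big_ind (fun X : 'M[C]_n => X \is unitarymx)) => //.
  exact: unitary1.
by move=> X Y hX hY; apply: mul_unitarymx.
Qed.

End Adjoint.

Section UnitaryDiagonal.
Variables (C : numClosedFieldType) (k : nat).
Implicit Types (A B P U : 'M[C]_k) (d e : 'I_k -> C).

Definition udiag P d : 'M[C]_k := P^t* *m diag_mx (\row_j d j) *m P.

Lemma eq_udiag P d e : d =1 e -> udiag P d = udiag P e.
Proof. by move=> /funext ->. Qed.

Lemma diag_rowM d e : diag_mx (\row_j d j) *m diag_mx (\row_j e j) =
  diag_mx (\row_j (d j * e j)) :> 'M[C]_k.
Proof. by rewrite mulmx_diag; congr diag_mx; apply/rowP => j; rewrite !mxE. Qed.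

Lemma udiagM P d e : P \is unitarymx -> udiag P d *m udiag P e = udiag P (fun j => d j * e j).
Proof.
move=> hP; rewrite /udiag -diag_rowM.
rewrite mulmxA; congr (_ *m P); rewrite !mulmxA.
by rewrite -(mulmxA _ P (P^t*)) unitaryVr // mulmx1.
Qed.

Lemma udiagD P d e : udiag P d + udiag P e = udiag P (fun j => d j + e j).
Proof.
have h : diag_mx (\row_j (d j + e j)) = diag_mx (\row_j d j) + diag_mx (\row_j e j).
  by apply/matrixP => i j; rewrite !mxE mulrnDl.
by rewrite /udiag h mulmxDr mulmxDl.
Qed.

Lemma udiagZ P (c : C) d : c *: udiag P d = udiag P (fun j => c * d j).
Proof.
have h : diag_mx (\row_j (c * d j)) = c *: diag_mx (\row_j d j).
  by apply/matrixP => i j; rewrite !mxE mulrnAr.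
by rewrite /udiag h -scalemxAr -scalemxAl.
Qed.

Lemma udiagB P d e : udiag P d - udiag P e = udiag P (fun j => d j - e j).
Proof.
rewrite -scaleN1r udiagZ udiagD; apply: eq_udiag => j; by rewrite mulN1r.
Qed.

Lemma adj_udiag P d : (udiag P d)^t* = udiag P (fun j => (d j)^*).
Proof.
rewrite /udiag ctmxM ctmxM trmxCK mulmxA tr_diag_mx map_diag_mx; congr (_ *m diag_mx _ *m _).
by apply/rowP => j; rewrite !mxE.
Qed.

Lemma udiag1 P : P \is unitarymx -> udiag P (fun=> 1) = 1%:M.
Proof.
move=> hP; rewrite /udiag (_ : diag_mx _ = 1%:M) ?mulmx1 ?unitaryVl //.
by rewrite -diag_const_mx; congr diag_mx; apply/rowP => j; rewrite !mxE.
Qed.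

Lemma udiag_unitary P d : P \is unitarymx -> (forall j, d j * (d j)^* = 1) ->
  udiag P d \is unitarymx.
Proof.
move=> hP hd; apply/unitarymxP; rewrite adj_udiag udiagM // -(udiag1 hP).
exact: eq_udiag.
Qed.

Lemma udiag_hermsym P d : (forall j, (d j)^* = d j) -> udiag P d \is hermsymmx.
Proof. by move=> h; apply/hermsymE; rewrite adj_udiag; apply: eq_udiag. Qed.

Lemma invmx_udiag P (r : 'rV[C]_k) : P \is unitarymx ->
  invmx P *m diag_mx r *m P = udiag P (r 0).
Proof.
move=> hP; rewrite /udiag invmx_unitary //; congr (_ *m diag_mx _ *m _).
by apply/rowP => j; rewrite mxE.
Qed.

Lemma hermsym_udiag A : A \is hermsymmx ->
  A = udiag (spectralmx A) (fun j => spectral_diag A 0 j).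
Proof.
move=> hA; have hP := spectral_unitarymx A.
have /orthomx_spectralP {1}-> := hermitian_normalmx hA.
by rewrite /udiag invmx_unitary //; congr (_ *m diag_mx _ *m _); apply/rowP => j; rewrite mxE.
Qed.

(** A functional calculus does not depend on the diagonalisation: the unitary Q
    intertwining two diagonal forms has entries only between equal values of a
    and b, so it also intertwines their images under f. *)
Lemma udiag_transfer (T : Type) (g f : T -> C) P U (a b : 'I_k -> T) :
  injective g -> P \is unitarymx -> U \is unitarymx ->
  udiag P (g \o a) = udiag U (g \o b) -> udiag P (f \o a) = udiag U (f \o b).
Proof.
move=> ginj hP hU h; pose Q := U *m P^t*.
have key (F : T -> C) : udiag P (F \o a) = udiag U (F \o b) <->
    Q *m diag_mx (\row_j F (a j)) = diag_mx (\row_j F (b j)) *m Q.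
  rewrite /udiag /Q; split.
    move=> /(congr1 (fun X => U *m X *m P^t*)).
    rewrite !mulmxA (unitaryVr hU) mul1mx -(mulmxA _ P) (unitaryVr hP) mulmx1 => ->.
    by [].
  move=> /(congr1 (fun X => U^t* *m X *m P)).
  rewrite !mulmxA (unitaryVl hU) mul1mx => ->.
  by rewrite -(mulmxA _ (P^t*) P) (unitaryVl hP) mulmx1.
clearbody Q; apply/key; move/key: h => /matrixP h; apply/matrixP => i j; move: (h i j).
rewrite !mul_mx_diag !mul_diag_mx !mxE => hij.
have [ab|nab] := EM (b i = a j); first by rewrite ab mulrC.
suff -> : Q i j = 0 by rewrite mulr0 mul0r.
have : Q i j * (g (a j) - g (b i)) = 0 by rewrite mulrBr hij mulrC subrr.
move/eqP; rewrite mulf_eq0 subr_eq0 => /orP[/eqP //|/eqP /ginj /esym ab].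
by case: nab.
Qed.

Lemma trace_udiag A P d : \tr (A *m udiag P d) = \sum_j (P *m A *m P^t*) j j * d j.
Proof.
rewrite /udiag !mulmxA mxtrace_mulC !mulmxA; apply: eq_bigr => j _.
by rewrite mul_mx_diag !mxE.
Qed.

Lemma trace_udiag2 A B P d e : \tr (A *m (udiag P d *m B *m udiag P e)) =
  \sum_i \sum_j (P *m A *m P^t*) j i * d i * (P *m B *m P^t*) i j * e j.
Proof.
have -> : A *m (udiag P d *m B *m udiag P e) = A *m P^t* *m
    (diag_mx (\row_j d j) *m (P *m B *m P^t*) *m diag_mx (\row_j e j)) *m P.
  by rewrite /udiag !mulmxA.
set K := _ *m _ *m diag_mx _.
rewrite (mxtrace_mulC _ P) mulmxA (mxtrace_mulC _ K) (mulmxA P A).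
rewrite /mxtrace; apply: eq_bigr => i _; rewrite mxE; apply: eq_bigr => j _.
rewrite /K mul_mx_diag mul_diag_mx !mxE.
by rewrite mulrC -!mulrA.
Qed.

End UnitaryDiagonal.

(** * The seminorm of a state *)

Section SemiInner.
Variables (C : numClosedFieldType) (k : nat).
Implicit Types (rho A B : 'M[C]_k).

(** Positivity over any closed field; at R[i] this is [psd]. *)
Definition gpsd rho : Prop :=
  rho \is hermsymmx /\ forall x : 'cV[C]_k, 0 <= (x ^t* *m rho *m x) 0 0.

Lemma gpsd_diag_ge0 rho A i : gpsd rho -> 0 <= (A *m rho *m A^t*) i i.
Proof.
move=> [_ /(_ ((row i A)^t*))].
rewrite trmxCK -row_mul mxE.
rewrite (_ : (A *m rho *m A^t*) i i = \sum_j row i (A *m rho) 0 j * (row i A)^t* j 0) //.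
by rewrite mxE; apply: eq_bigr => j _; rewrite !mxE.
Qed.

(** The semi-inner product of the GNS construction for rho. *)
Definition ip rho A B : C := \tr (rho *m (A^t* *m B)).

Lemma ip_cycle rho A B : ip rho A B = \tr (B *m rho *m A^t*).
Proof. by rewrite /ip mulmxA mxtrace_mulC mulmxA. Qed.

Lemma ip_ge0 rho A : gpsd rho -> 0 <= ip rho A A.
Proof.
by move=> h; rewrite ip_cycle; apply: sumr_ge0 => i _; exact: gpsd_diag_ge0.
Qed.

Lemma ipC rho A B : gpsd rho -> ip rho B A = (ip rho A B)^*.
Proof.
move=> [/hermsymE h _]; rewrite -trace_adj ctmxM ctmxM trmxCK h /ip mxtrace_mulC.
by [].
Qed.

Lemma ipDl rho A A' B : ip rho (A + A') B = ip rho A B + ip rho A' B.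
Proof. by rewrite /ip ctmxD mulmxDl mulmxDr mxtraceD. Qed.

Lemma ipDr rho A B B' : ip rho A (B + B') = ip rho A B + ip rho A B'.
Proof. by rewrite /ip mulmxDr mulmxDr mxtraceD. Qed.

Lemma ipZl rho c A B : ip rho (c *: A) B = c^* * ip rho A B.
Proof. by rewrite /ip ctmxZ -scalemxAl -scalemxAr mxtraceZ. Qed.

Lemma ipZr rho c A B : ip rho A (c *: B) = c * ip rho A B.
Proof. by rewrite /ip -!scalemxAr mxtraceZ. Qed.

Lemma ipNl rho A B : ip rho (- A) B = - ip rho A B.
Proof. by rewrite -scaleN1r ipZl rmorphN1 mulN1r. Qed.

Lemma ipNr rho A B : ip rho A (- B) = - ip rho A B.
Proof. by rewrite -scaleN1r ipZr mulN1r. Qed.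

Lemma ip_add rho A B : gpsd rho ->
  ip rho (A + B) (A + B) = ip rho A A + ip rho A B + ((ip rho A B)^* + ip rho B B).
Proof. by move=> h; rewrite ipDl !ipDr (ipC A B h). Qed.

(** Evaluate the form on c A - conj b B, where a, b, c are its three values; if
    c = 0, evaluate it on a B - b A instead, or on A - conj b B if also a = 0. *)
Lemma ip_cauchy_schwarz rho A B : gpsd rho ->
  ip rho A B * (ip rho A B)^* <= ip rho A A * ip rho B B.
Proof.
move=> h; set a := ip rho A A; set c := ip rho B B; set b := ip rho A B.
have a0 : 0 <= a by exact: ip_ge0.
have c0 : 0 <= c by exact: ip_ge0.
have key l m : 0 <= l^* * l * a + l^* * m * b + m^* * l * b^* + m^* * m * c.
  have := ip_ge0 (l *: A + m *: B) h.
  rewrite ipDl !ipDr !ipZl !ipZr -/a -/b -/c (ipC A B h) -/b.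
  by rewrite !mulrA !addrA.
have aR : a^* = a by apply: geC0_conj.
have cR : c^* = c by apply: geC0_conj.
have nbR : (- b^*)^* = - b by rewrite rmorphN /= conjCK.
have [ce0|cn0] := eqVneq c 0; last first.
  have cp : 0 < c by rewrite lt_def cn0.
  have := key c (- b^*); rewrite nbR cR => hk.
  rewrite -subr_ge0 -(pmulr_rge0 _ cp); apply: le_trans hk _.
  by rewrite le_eqVlt; apply/orP; left; apply/eqP; ring.
have [ae0|an0] := eqVneq a 0; last first.
  have ap : 0 < a by rewrite lt_def an0.
  have := key (- b) a; rewrite rmorphN /= aR => hk.
  rewrite -subr_ge0 -(pmulr_rge0 _ ap); apply: le_trans hk _.
  by rewrite le_eqVlt; apply/orP; left; apply/eqP; ring.
have := key 1 (- b^*); rewrite nbR rmorph1 ce0 ae0 !mulr0 addr0 add0r => hk.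
rewrite -oppr_ge0 -(pmulr_rge0 _ (ltr0n _ 2)); apply: le_trans hk _.
by rewrite le_eqVlt; apply/orP; left; apply/eqP; ring.
Qed.

Lemma ip_unitary rho U A B : U \is unitarymx -> ip rho (U *m A) (U *m B) = ip rho A B.
Proof.
move=> hU; rewrite /ip ctmxM !mulmxA; congr (\tr (_ *m _)).
by rewrite -(mulmxA _ (U^t*)) unitaryVl // mulmx1.
Qed.

(** By Cauchy-Schwarz a null vector is orthogonal to every B. Choosing for B the
    adjoint of rho *m A^t* gives the squared Frobenius norm of that product. *)
Lemma gpsd_eq0 rho A : gpsd rho -> ip rho A A = 0 -> rho *m A^t* = 0.
Proof.
move=> h h0; apply/eqP/negPn/negP => n0.
have h1 B : ip rho A B = 0.
  have := ip_cauchy_schwarz A B h; rewrite h0 mul0r => hb.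
  have : ip rho A B * (ip rho A B)^* = 0.
    by apply/eqP; rewrite eq_le hb mul_conjC_ge0.
  by move/eqP; rewrite mul_conjC_eq0 => /eqP.
pose D := rho *m A^t*.
have : \tr (D *m D^t*) = 0.
  by rewrite -(h1 (D^t*)) /ip mulmxA.
rewrite /mxtrace => /eqP; rewrite psumr_eq0 => [/allP hall|i _]; last first.
  by rewrite mxE; apply: sumr_ge0 => j _; rewrite !mxE mul_conjC_ge0.
move/eqP: n0; apply; apply/matrixP => i j; rewrite [RHS]mxE.
have /eqP := hall i (mem_index_enum i).
rewrite mxE => /eqP; rewrite psumr_eq0 => [/allP hi|l _]; last by rewrite !mxE mul_conjC_ge0.
by have := hi j (mem_index_enum j); rewrite [D^t* _ _]mxE [D^T _ _]mxE mul_conjC_eq0 => /eqP.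
Qed.

End SemiInner.

Lemma le_of_sqr (R : realDomainType) (x y : R) : 0 <= y -> x ^+ 2 <= y ^+ 2 -> x <= y.
Proof.
move=> y0; case: (leP x y) => // xy; rewrite leNgt => /negP []; nra.
Qed.

Section StateNorm.
Variables (R : realType) (k : nat) (rho : 'M[R[i]]_k).
Hypothesis hrho : psd rho.
Implicit Types A B U : 'M[R[i]]_k.

Let grho : gpsd rho. Proof. exact: hrho. Qed.

Definition nrm A : R := Num.sqrt (complex.Re (ip rho A A)).

Lemma ip_real A : ip rho A A = (complex.Re (ip rho A A))%:C.
Proof. by rewrite RRe_real // ger0_real // ip_ge0. Qed.

Lemma Re_ip_ge0 A : 0 <= complex.Re (ip rho A A).
Proof. by rewrite -ler0c -ip_real ip_ge0. Qed.

Lemma nrm_ge0 A : 0 <= nrm A.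
Proof. exact: sqrtr_ge0. Qed.

Lemma nrm_sqr A : nrm A ^+ 2 = complex.Re (ip rho A A).
Proof. by rewrite sqr_sqrtr // Re_ip_ge0. Qed.

Lemma ip_nrm A : ip rho A A = (nrm A ^+ 2)%:C.
Proof. by rewrite nrm_sqr -ip_real. Qed.

Lemma sqr_normc_conj (z : R[i]) : (normc z ^+ 2)%:C = z * (z^*)%R.
Proof. by rewrite -normCK normc_norm -(rmorphXn (real_complex R)). Qed.

Lemma normc_ip A B : normc (ip rho A B) <= nrm A * nrm B.
Proof.
have h := ip_cauchy_schwarz A B grho.
rewrite (ip_nrm A) (ip_nrm B) -(rmorphM (real_complex R)) -sqr_normc_conj lecR in h.
apply: le_of_sqr; first by apply: mulr_ge0; exact: nrm_ge0.
by rewrite exprMn.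
Qed.

Lemma nrmD A B : nrm (A + B) <= nrm A + nrm B.
Proof.
apply: le_of_sqr; first by apply: addr_ge0; exact: nrm_ge0.
rewrite nrm_sqr sqrrD !nrm_sqr.
have := le_trans (Re_le_normc (ip rho A B)) (normc_ip A B) => /(le_trans (ler_norm _)).
rewrite (ip_add A B grho).
move: (ip rho A A) (ip rho A B) (ip rho B B) (nrm A * nrm B) => [a a'] [b b'] [c c'] x /=.
lra.
Qed.

Lemma nrmN A : nrm (- A) = nrm A.
Proof. by rewrite /nrm ipNl ipNr opprK. Qed.

Lemma nrmB A B : nrm (A - B) <= nrm A + nrm B.
Proof. by rewrite -(nrmN B); exact: nrmD. Qed.

Lemma nrm_unitary U A : U \is unitarymx -> nrm (U *m A) = nrm A.
Proof. by move=> hU; rewrite /nrm ip_unitary. Qed.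

End StateNorm.

(** * The likelihood ratio on the support of the state *)

Section LikelihoodUnique.
Variables (C : numClosedFieldType) (k : nat).
Implicit Types (rho sigma tau A B L P Q : 'M[C]_k).

Lemma gpsd_udiag P (d : 'I_k -> C) : (forall j, 0 <= d j) -> gpsd (udiag P d).
Proof.
move=> d0; split; first by apply: udiag_hermsym => j; rewrite geC0_conj.
move=> x; rewrite /udiag; pose y := P *m x.
have -> : x^t* *m (P^t* *m diag_mx (\row_j d j) *m P) *m x
   = y^t* *m diag_mx (\row_j d j) *m y by rewrite /y ctmxM !mulmxA.
rewrite mxE; apply: sumr_ge0 => j _; rewrite mul_mx_diag !mxE.
by rewrite mulrAC mulr_ge0 // mulrC mul_conjC_ge0.
Qed.

Lemma gpsd_spectral_ge0 A j : gpsd A -> 0 <= spectral_diag A 0 j.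
Proof.
move=> hA; have hP := spectral_unitarymx A.
have := gpsd_diag_ge0 (spectralmx A) j hA.
rewrite {2}(hermsym_udiag hA.1) /udiag !mulmxA unitaryVr // mul1mx.
rewrite -mulmxA unitaryVr // mulmx1 mxE eqxx mulr1n mxE.
by [].
Qed.

Lemma gpsd_sqrt A : gpsd A -> exists2 Q, gpsd Q & Q *m Q = A.
Proof.
move=> hA; have hP := spectral_unitarymx A.
exists (udiag (spectralmx A) (fun j => sqrtC (spectral_diag A 0 j))).
  by apply: gpsd_udiag => j; rewrite sqrtC_ge0 gpsd_spectral_ge0.
rewrite udiagM // [RHS](hermsym_udiag hA.1); apply: eq_udiag => j.
by rewrite -expr2 sqrtCK.
Qed.

Lemma gpsd1 : gpsd (1%:M : 'M[C]_k).
Proof. by rewrite -(udiag1 (unitary1 C k)); apply: gpsd_udiag => j; exact: ler01. Qed.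

Lemma mul_ctmx_eq0 A : A *m A^t* = 0 -> A = 0.
Proof.
move=> h; have : ip 1%:M (A^t*) (A^t*) = 0 by rewrite /ip mul1mx trmxCK h mxtrace0.
by move/(gpsd_eq0 gpsd1); rewrite mul1mx trmxCK.
Qed.

(** With D = A - B one has A D + D B = A^2 - B^2 = 0, so the nonnegative numbers
    Tr A D^2 and Tr B D^2 add up to 0; hence A D = B D = 0 and D^2 = 0. *)
Lemma gpsd_sqrt_inj A B : gpsd A -> gpsd B -> A *m A = B *m B -> A = B.
Proof.
move=> hA hB h; pose D := A - B.
have hD : D^t* = D.
  by rewrite /D ctmxB (hermsymE A).1 ?(hermsymE B).1 //; [exact: hB.1|exact: hA.1].
have h1 : A *m D + D *m B = 0.
  by rewrite /D mulmxBr mulmxBl addrA subrK h subrr.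
have h2 : ip A D D + ip B D D = 0.
  have -> : ip A D D = \tr (D *m (A *m D)) by rewrite /ip hD mulmxA [RHS]mxtrace_mulC.
  have -> : ip B D D = \tr (D *m (D *m B)) by rewrite /ip hD mxtrace_mulC mulmxA.
  by rewrite -mxtraceD -mulmxDr h1 mulmx0 mxtrace0.
have [a0 b0] : ip A D D = 0 /\ ip B D D = 0.
  move/eqP: h2; rewrite paddr_eq0 ?ip_ge0 // => /andP[/eqP -> /eqP ->] //.
have := gpsd_eq0 hA a0; have := gpsd_eq0 hB b0; rewrite hD => BD AD.
have /mul_ctmx_eq0/eqP : D *m D^t* = 0 by rewrite hD {1}/D mulmxBl AD BD subrr.
by rewrite subr_eq0 => /eqP.
Qed.

Lemma mul_gpsd_eq0 Q A : Q \is hermsymmx -> A *m (Q *m Q) = 0 -> A *m Q = 0.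
Proof.
move=> /hermsymE hQ h; apply: mul_ctmx_eq0.
by rewrite ctmxM hQ mulmxA -(mulmxA A) h mul0mx.
Qed.

(** The form of L vanishes at Q v for v in the kernel of Q L Q, and a positive L
    kills its null vectors. *)
Lemma gpsd_sandwich_ker Q L A : Q \is hermsymmx -> gpsd L ->
  Q *m L *m Q *m A = 0 -> L *m Q *m A = 0.
Proof.
move=> /hermsymE hQ hL h.
have : ip L (A^t* *m Q) (A^t* *m Q) = 0.
  rewrite ip_cycle ctmxM trmxCK hQ (_ : _ *m _ = A^t* *m (Q *m L *m Q *m A)).
    by rewrite h mulmx0 mxtrace0.
  by rewrite !mulmxA.
by move/(gpsd_eq0 hL); rewrite ctmxM trmxCK hQ mulmxA.
Qed.

(** Let Q be the square root of rho. Since tau and tau' vanish on rho, cutting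
    down by Q gives (Q L Q)^2 = (Q L' Q)^2, so both sides have the same root r.
    Then N = (L - L') Q vanishes on the range of r, and on its kernel by
    [gpsd_sandwich_ker]. *)
Lemma likelihood_unique rho L L' tau tau' :
  gpsd rho -> gpsd L -> gpsd L' -> tau *m rho = 0 -> tau' *m rho = 0 ->
  L *m rho *m L + tau = L' *m rho *m L' + tau' -> L *m rho = L' *m rho.
Proof.
move=> hrho hL hL' t0 t0' h.
have [Q hQ QQ] := gpsd_sqrt hrho.
have /hermsymE Lh := hL.1; have /hermsymE Lh' := hL'.1; have /hermsymE Qh := hQ.1.
pose M := L *m rho *m L - L' *m rho *m L'.
have M0 : M *m rho = 0.
  move/(congr1 (fun X => X *m rho)): h; rewrite !mulmxDl t0 t0' !addr0 => h.
  by rewrite mulNmx h subrr.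
have MQ : M *m Q = 0 by apply: mul_gpsd_eq0; [exact: hQ.1|rewrite QQ].
have eqQ : L *m rho *m L *m Q = L' *m rho *m L' *m Q.
  by apply/eqP; rewrite -subr_eq0 -mulmxBl MQ.
have sand (X : 'M[C]_k) : gpsd X -> gpsd (Q *m X *m Q).
  move=> [/hermsymE hX1 hX2]; split.
    by apply/hermsymE; rewrite !ctmxM hX1 Qh mulmxA.
  by move=> x; have := hX2 (Q *m x); rewrite ctmxM Qh !mulmxA.
have rr : Q *m L *m Q = Q *m L' *m Q.
  apply: gpsd_sqrt_inj; [exact: sand|exact: sand|].
  have e (X : 'M[C]_k) : Q *m X *m Q *m (Q *m X *m Q) = Q *m (X *m rho *m X *m Q).
    by rewrite -QQ !mulmxA.
  by rewrite !e eqQ.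
pose N := (L - L') *m Q.
have Nr : N *m (Q *m L *m Q) = 0.
  have e : N *m (Q *m L *m Q) = L *m Q *m (Q *m L *m Q) - L' *m Q *m (Q *m L' *m Q).
    by rewrite -rr /N !mulmxBl.
  have e' (X : 'M[C]_k) : X *m Q *m (Q *m X *m Q) = X *m rho *m X *m Q by rewrite -QQ !mulmxA.
  by rewrite e !e' eqQ subrr.
have rN : Q *m L *m Q *m N^t* = 0.
  move/(congr1 (fun X : 'M[C]_k => X^t*)): Nr; rewrite ctmxM ctmx0 => <-.
  by rewrite !ctmxM Lh Qh !mulmxA.
have h1 := gpsd_sandwich_ker hQ.1 hL rN.
rewrite rr in rN; have h2 := gpsd_sandwich_ker hQ.1 hL' rN.
have /mul_ctmx_eq0 N0 : N *m N^t* = 0 by rewrite {1}/N !mulmxBl h1 h2 subrr.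
by apply/eqP; rewrite -subr_eq0 -mulmxBl -QQ mulmxA -/N N0 mul0mx.
Qed.

End LikelihoodUnique.

(** The hypothesis says tau rho tau = 0, that is, tau is null for the form of rho. *)
Lemma gpsd_orth_mul0 (C : numClosedFieldType) k (rho tau : 'M[C]_k) :
  gpsd tau -> gpsd rho ->
  (forall v w : 'cV[C]_k, ((tau *m v)^t* *m rho *m (tau *m w)) 0 0 = 0) ->
  tau *m rho = 0.
Proof.
move=> htau hrho hp.
have /hermsymE th := htau.1; have /hermsymE rh := hrho.1.
have h0 : tau *m rho *m tau = 0.
  apply/matrixP => i j; rewrite [RHS]mxE -(hp (delta_mx i 0) (delta_mx j 0)).
  rewrite ctmxM th trmx_delta map_delta_mx !mulmxA -mulmxA -colE -!mulmxA.
  by rewrite -rowE !mxE; apply: eq_bigr => l _; rewrite !mxE.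
have : ip rho tau tau = 0 by rewrite ip_cycle th h0 mxtrace0.
move/(gpsd_eq0 hrho)/(congr1 (fun X : 'M[C]_k => X^t*)).
by rewrite th ctmxM th rh ctmx0.
Qed.

Section Perp.
Variables (R : realType) (k : nat).
Implicit Types (rho tau sigma L : 'M[R[i]]_k).

(** The range of tau lies in its support. *)
Lemma perp_mul0 rho tau : psd tau -> psd rho -> perp tau rho -> tau *m rho = 0.
Proof.
move=> htau hrho hp; apply: (gpsd_orth_mul0 htau hrho) => v w.
have /hermsymE th := htau.1.
have supp_tau (u : 'cV[R[i]]_k) : supp tau (tau *m u).
  move=> z hz; rewrite mulmxA.
  have -> : z^t* *m tau = 0 by rewrite -th -ctmxM hz ctmx0.
  by rewrite mul0mx mxE.
exact: hp.
Qed.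

Lemma sqrt_lr_unique sigma rho L L' : psd rho -> sqrt_lr sigma rho L -> sqrt_lr sigma rho L' ->
  L *m rho = L' *m rho.
Proof.
move=> hrho [hL [tau [ht hp hs]]] [hL' [tau' [ht' hp' hs']]].
apply: (likelihood_unique hrho hL hL' (perp_mul0 ht hrho hp) (perp_mul0 ht' hrho hp')).
by rewrite -hs -hs'.
Qed.

End Perp.

(** * The spectral law of the logarithm *)

Section LogSpectrum.
Variables (R : realType) (k : nat).
Implicit Types (rho A B : 'M[R[i]]_k).
Local Notation Re := (@complex.Re R).

Definition eig A (j : 'I_k) : R := Re (spectral_diag A 0 j).

Lemma eigE A j : observable A -> spectral_diag A 0 j = (eig A j)%:C.
Proof.
move=> hA; have /mxOverP /(_ 0 j) h := hermitian_spectral_diag_real hA.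
by rewrite /eig RRe_real.
Qed.

Lemma observable_udiag A : observable A ->
  A = udiag (spectralmx A) (fun j => (eig A j)%:C).
Proof. by move=> hA; rewrite {1}(hermsym_udiag hA); apply: eq_udiag => j; exact: eigE. Qed.

Lemma hfunE f A : hfun f A = udiag (spectralmx A) (fun j => f (eig A j)).
Proof.
rewrite /hfun (invmx_udiag _ (spectral_unitarymx A)); apply: eq_udiag => j.
by rewrite mxE.
Qed.

Lemma real_udiag_obs P (a : 'I_k -> R) : observable (udiag P (fun j => (a j)%:C)).
Proof. by apply: udiag_hermsym => j; exact: (conjc_real (a j)). Qed.

(** [hfun] is computed from the diagonalisation chosen by [spectralmx];
    [udiag_transfer] moves the result to the given one. *)
Lemma hfun_udiag P (a : 'I_k -> R) (f : R -> R[i]) : P \is unitarymx ->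
  hfun f (udiag P (fun j => (a j)%:C)) = udiag P (fun j => f (a j)).
Proof.
move=> hP; rewrite hfunE.
apply: (udiag_transfer f (@complexI R) (spectral_unitarymx _) hP).
by rewrite -(observable_udiag (real_udiag_obs P a)).
Qed.

Lemma mexpiZ_udiag P (a : 'I_k -> R) (t : R) : P \is unitarymx ->
  mexpi (t%:C *: udiag P (fun j => (a j)%:C)) = udiag P (fun j => cis (t * a j)).
Proof.
move=> hP; rewrite udiagZ.
rewrite (_ : udiag P _ = udiag P (fun j => (t * a j)%:C)); last first.
  by apply: eq_udiag => j; rewrite rmorphM.
exact: (hfun_udiag _ _ hP).
Qed.

Lemma obsD A B : observable A -> observable B -> observable (A + B).
Proof. by move=> /hermsymE hA /hermsymE hB; apply/hermsymE; rewrite ctmxD hA hB. Qed.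

Lemma obsZr (c : R) A : observable A -> observable (c%:C *: A).
Proof.
move=> /hermsymE hA; apply/hermsymE; rewrite ctmxZ hA; congr (_ *: _).
exact: conjc_real.
Qed.

Lemma obsB A B : observable A -> observable B -> observable (A - B).
Proof. by move=> /hermsymE hA /hermsymE hB; apply/hermsymE; rewrite ctmxB hA hB. Qed.

Lemma obs_sum (I : Type) (l : seq I) (F : I -> 'M[R[i]]_k) :
  (forall i, observable (F i)) -> observable (\sum_(i <- l) F i).
Proof.
move=> h; apply: (big_ind (fun A : 'M[R[i]]_k => observable A)).
- by apply/hermsymE; rewrite ctmx0.
- exact: obsD.
- by move=> i _; exact: h.
Qed.

Lemma mexpi_unitary A : observable A -> mexpi A \is unitarymx.
Proof.
move=> hA; rewrite /mexpi hfunE; apply: udiag_unitary; first exact: spectral_unitarymx.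
by move=> j; rewrite -/(cis _) cis_conj cisVK.
Qed.

Lemma adj_mexpi A : observable A -> (mexpi A)^t* = mexpi (- A).
Proof.
move=> hA; have hP := spectral_unitarymx A.
have e : - A = (-1)%:C *: udiag (spectralmx A) (fun j => (eig A j)%:C).
  by rewrite -(observable_udiag hA) rmorphN1 scaleN1r.
rewrite e mexpiZ_udiag // /mexpi hfunE adj_udiag; apply: eq_udiag => j.
by rewrite -/(cis _) cis_conj mulN1r.
Qed.

(** The law of 2 log B in the state rho has the atoms [lw B j], with weights
    [pr rho B j]. *)
Definition lw B j : R := 2 * ln (eig B j).
Definition pr rho B j : R := Re ((spectralmx B *m rho *m (spectralmx B)^t*) j j).

Lemma pd_psd B : pd B -> psd B.
Proof.
move=> [h1 h2]; split => // x; have [->|/h2/ltW //] := eqVneq x 0.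
by rewrite mulmx0 mxE.
Qed.

Lemma pd_eig_gt0 B j : pd B -> 0 < eig B j.
Proof.
move=> hB; have hP := spectral_unitarymx B.
have := gpsd_spectral_ge0 j (pd_psd hB).
rewrite (eigE _ hB.1) ler0c le_eqVlt => /orP[/eqP e0|//].
exfalso; pose x := (spectralmx B)^t* *m delta_mx j (0 : 'I_1).
have x0 : x != 0.
  apply/eqP => /(congr1 (mulmx (spectralmx B))).
  rewrite mulmxA unitaryVr // mul1mx mulmx0 => /matrixP /(_ j 0).
  by rewrite !mxE !eqxx => /eqP; rewrite oner_eq0.
have Bx : B *m x = 0.
  rewrite [in LHS](observable_udiag hB.1) /udiag /x -!mulmxA.
  rewrite (mulmxA (spectralmx B)) unitaryVr // mul1mx -colE.
  rewrite (_ : col j _ = 0) ?mulmx0 //; apply/matrixP => i l; rewrite !mxE.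
  by have [->|] := eqVneq i j; rewrite ?mulr0n // -e0 mulr1n.
by have := hB.2 _ x0; rewrite -mulmxA Bx mulmx0 mxE ltxx.
Qed.

Lemma pd_udiag B : pd B -> B = udiag (spectralmx B) (fun j => (expR (lw B j / 2))%:C).
Proof.
move=> hB; rewrite {1}(observable_udiag hB.1); apply: eq_udiag => j.
by rewrite /lw mulrAC divff // mul1r lnK // posrE pd_eig_gt0.
Qed.

Lemma mlog_udiag B : mlog B = udiag (spectralmx B) (fun j => (lw B j / 2)%:C).
Proof.
rewrite /mlog hfunE; apply: eq_udiag => j.
by rewrite /lw mulrAC divff // mul1r.
Qed.

Lemma mlog_obs B : observable (mlog B).
Proof. by rewrite mlog_udiag; exact: real_udiag_obs. Qed.

Lemma mexpi_mlog B (t : R) :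
  mexpi (t%:C *: mlog B) = udiag (spectralmx B) (fun j => cis (t * (lw B j / 2))).
Proof. by rewrite mlog_udiag mexpiZ_udiag ?spectral_unitarymx. Qed.

Lemma prE rho B j : psd rho ->
  (spectralmx B *m rho *m (spectralmx B)^t*) j j = (pr rho B j)%:C.
Proof.
move=> h; have /ger0_real/RRe_real <- // : 0 <= (spectralmx B *m rho *m (spectralmx B)^t*) j j.
exact: gpsd_diag_ge0.
Qed.

Lemma pr_ge0 rho B j : psd rho -> 0 <= pr rho B j.
Proof. by move=> h; rewrite -ler0c -prE //; exact: gpsd_diag_ge0. Qed.

Lemma trace_pr rho B d : psd rho ->
  \tr (rho *m udiag (spectralmx B) d) = \sum_j (pr rho B j)%:C * d j.
Proof. by move=> h; rewrite trace_udiag; apply: eq_bigr => j _; rewrite prE. Qed.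

Lemma pr_sum1 rho B : state rho -> \sum_j pr rho B j = 1.
Proof.
move=> [h t1]; apply: (@complexI R).
have := trace_pr B (fun=> 1) h; rewrite udiag1 ?spectral_unitarymx // mulmx1 t1.
move=> h2; apply: (etrans _ (esym h2)); rewrite rmorph_sum.
by apply: eq_bigr => j _; rewrite mulr1.
Qed.

Lemma nrm_udiag rho B d : psd rho ->
  nrm rho (udiag (spectralmx B) d) ^+ 2 = \sum_j pr rho B j * normc (d j) ^+ 2.
Proof.
move=> h; rewrite nrm_sqr // /ip adj_udiag udiagM ?spectral_unitarymx // trace_pr //.
rewrite (_ : \sum_j _ = (\sum_j pr rho B j * normc (d j) ^+ 2)%:C) //.
rewrite rmorph_sum; apply: eq_bigr => j _.
by rewrite rmorphM /= sqr_normc_conj [X in _ * X]mulrC.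
Qed.

Lemma nrm_unitary1 rho U : state rho -> U \is unitarymx -> nrm rho U = 1.
Proof.
by move=> [h t1] hU; rewrite /nrm /ip unitaryVl // mulmx1 t1 /= sqrtr1.
Qed.

Lemma ip_unitary_le rho U A B : state rho -> U \is unitarymx ->
  normc (\tr (rho *m (A *m U *m B))) <= nrm rho (A^t*) * nrm rho B.
Proof.
move=> [h t1] hU; have -> : \tr (rho *m (A *m U *m B)) = ip rho (A^t*) (U *m B).
  by rewrite /ip trmxCK (mulmxA A).
by apply: le_trans (normc_ip h _ _) _; rewrite nrm_unitary.
Qed.

End LogSpectrum.

(** * Exponential moments from characteristic functions *)

Section Core.
Variable (R : realType) (k : nat -> nat).
Variables (p w : forall n, 'I_(k n) -> R) (s : R).
Arguments p : clear implicits.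
Arguments w : clear implicits.
Hypothesis p_ge0 : forall n j, 0 <= p n j.
Hypothesis p_sum : forall n, \sum_j p n j = 1.

(** The characteristic function of N(- s^2/2, s^2), under which exp w has
    expectation 1. *)
Definition phi (t : R) : R[i] := cgauss (s ^+ 2) (0 +i* (- (s ^+ 2 / 2))) t.

Hypothesis char_cvg : forall t : R,
  ctends (fun n => \sum_j (p n j)%:C * cis (t * w n j)) (phi t).

(** A damped exp (x / 2): it lies between 0 and exp (x / 2), is bounded for d > 0,
    and is a Gaussian average of the characters [cis (a * x)]. *)
Definition fdelta (d x : R) : R := expR (x / 2 - d * x ^+ 2 / 2).

(** The expectation of exp (w - d w^2) under N(- s^2/2, s^2). *)
Definition Flim (d : R) : R :=
  Num.sqrt (1 / (1 + 2 * d * s ^+ 2)) * expR (- (d * s ^+ 4 / (4 * (1 + 2 * d * s ^+ 2)))).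

Lemma normc_sum_p n (f : 'I_(k n) -> R[i]) (C : R) :
  (forall j, normc (f j) <= C) -> normc (\sum_j (p n j)%:C * f j) <= C.
Proof.
move=> h; apply: le_trans (normc_sum _ _ _) _.
rewrite -[leRHS]mul1r -(p_sum n) mulr_suml; apply: ler_sum => j _.
by rewrite normcM normc_real ger0_norm // ler_wpM2l.
Qed.

(** The weight exp (w - d w^2) is, up to the factor exp (1 / (4 d)), the average
    of the characters of w against the kernel with q = c = 1 / (2 d) and linear
    term - i c a: completing the square, - d (w - c)^2 = w - d w^2 - 1 / (4 d). *)
Lemma gaussian_moment_cvg (d : R) : 0 < d ->
  (fun n => \sum_j p n j * expR (w n j - d * w n j ^+ 2)) @ \oo --> Flim d.
Proof.
move=> d0; pose q := (2 * d)^-1; pose c := (2 * d)^-1.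
have dn : d != 0 by rewrite gt_eqF.
have q0 : 0 < q by rewrite invr_gt0 mulr_gt0.
have h := @gavg_cvg R q (s ^+ 2) (0 +i* (- c)) (0 +i* (- (s ^+ 2 / 2))) 1 1 0
  (fun n => 'I_(k n)) (fun n j => (p n j)%:C) (fun n j => 0 +i* w n j) q0 (sqr_ge0 s).
have eE n a : expsum (fun j => (p n j)%:C) (fun j => 0 +i* w n j) a
    = \sum_j (p n j)%:C * cis (a * w n j).
  by apply: eq_bigr => j _; rewrite imagM /cis mulrC [w n j * a]mulrC mulrC.
have h1 : forall n a, normc (expsum (fun j => (p n j)%:C) (fun j => 0 +i* w n j) a)
    <= 1 * expR (0 * `|a|).
  move=> n a; rewrite mul0r expR0 mulr1 eE; apply: normc_sum_p => j.
  by rewrite normc_cis.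
have h2 a : ctends (fun n => expsum (fun j => (p n j)%:C) (fun j => 0 +i* w n j) a)
    (1 * cgauss (s ^+ 2) (0 +i* (- (s ^+ 2 / 2))) a).
  by rewrite mul1r; apply: ctends_ext (char_cvg a) => n; rewrite eE.
have {h h1 h2} h := h h1 h2.
apply/ctends_real.
have := ctendsZ (expR (1 / (4 * d)))%:C h.
have -> : (expR (1 / (4 * d)))%:C * (1 * (Num.sqrt (q / (q + s ^+ 2)))%:C *
  cexp ((0 +i* (- (s ^+ 2 / 2)) + 0 +i* (- c)) ^+ 2 / ((q + s ^+ 2) *+ 2)%:C)) = (Flim d)%:C.
  rewrite imagD sqr_imag real_div cexp_real mul1r -!rmorphM; congr (_%:C).
  have x0 : 1 + 2 * d * s ^+ 2 != 0.
    rewrite gt_eqF //; apply: ltr_pwDl => //.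
    by apply: mulr_ge0; [apply: mulr_ge0 => //; exact: ltW | exact: sqr_ge0].
  rewrite !mul1r mulrCA -expRD /Flim mul1r; congr (_ * _).
    by congr (Num.sqrt _); rewrite /q; field; rewrite x0 dn.
  by congr expR; rewrite /q /c; field; rewrite x0 dn.
apply: ctends_ext => n; rewrite /gavg mulr_sumr rmorph_sum; apply: eq_bigr => j _.
rewrite imagD sqr_imag real_div cexp_real -!rmorphM; congr (_%:C).
rewrite mulrCA -expRD; congr (_ * expR _).
by rewrite /q /c; field; rewrite dn.
Qed.

(** A quantitative form of Flim d --> 1 as d --> 0. *)
Lemma Flim_lower (d : R) : 0 < d -> d * (2 * s ^+ 2 + s ^+ 4 / 4) <= 1 ->
  1 - d * (2 * s ^+ 2 + s ^+ 4 / 4) <= Flim d.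
Proof.
move=> d0; have s2 := sqr_ge0 s.
have s4 : 0 <= s ^+ 4 by rewrite -[4%N]/(2 * 2)%N exprM sqr_ge0.
set x := 2 * d * s ^+ 2; set y := d * s ^+ 4 / 4.
have -> : d * (2 * s ^+ 2 + s ^+ 4 / 4) = x + y by rewrite /x /y; field.
move=> xy1.
have x0 : 0 <= x by rewrite /x; nra.
have y0 : 0 <= y by rewrite /y divr_ge0 // mulr_ge0 // ltW.
have h1 : 1 - x <= Num.sqrt (1 / (1 + x)).
  have z0 : 0 <= 1 / (1 + x) by rewrite divr_ge0 // addr_ge0.
  have z1 : 1 / (1 + x) <= 1 by rewrite ler_pdivrMr ?mul1r ?lerDl // ltr_pwDl.
  have hz : 1 / (1 + x) <= Num.sqrt (1 / (1 + x)).
    rewrite -[leLHS](sqr_sqrtr z0) expr2 ler_piMl ?sqrtr_ge0 //.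
    by rewrite -[leRHS]sqrtr1; apply: ler_wsqrtr.
  apply: le_trans hz; rewrite ler_pdivlMr ?ltr_pwDl //; nra.
have h2 : 1 - y <= expR (- (d * s ^+ 4 / (4 * (1 + x)))).
  apply: le_trans (expR_ge1Dx _); rewrite lerD2l lerN2 /y invfM mulrA.
  by rewrite ler_piMr // invf_le1 ?lerDl // ltr_pwDl.
have h3 := sqrtr_ge0 (1 / (1 + x)).
rewrite /Flim -/x; set S := Num.sqrt _ in h1 h3 *; set E := expR _ in h2 *.
have : (1 - x) * (1 - y) <= S * E.
  apply: (@le_trans _ _ (S * (1 - y))); last by rewrite ler_wpM2l.
  by rewrite ler_wpM2r //; lra.
nra.
Qed.

Hypothesis mass_le : forall e : R, 0 < e ->
  \forall n \near \oo, \sum_j p n j * expR (w n j) <= 1 + e.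

(** The part of the mass E exp w which is lost by damping with exp (- d w^2). *)
Definition tail (d : R) n :=
  \sum_j p n j * (expR (w n j) * (1 - expR (- (d * w n j ^+ 2)))).

Lemma tailE d n : tail d n =
  \sum_j p n j * expR (w n j) - \sum_j p n j * expR (w n j - d * w n j ^+ 2).
Proof.
rewrite /tail -sumrB; apply: eq_bigr => j _.
by rewrite expRD; ring.
Qed.

Lemma tail_ge0 d n : 0 <= d -> 0 <= tail d n.
Proof.
move=> d0; apply: sumr_ge0 => j _; rewrite mulr_ge0 // mulr_ge0 ?expR_ge0 //.
by rewrite subr_ge0 -expR0 ler_expR oppr_le0 mulr_ge0 // sqr_ge0.
Qed.

Lemma moment_lower (e : R) : 0 < e -> exists2 d0 : R, 0 < d0 & forall d, 0 < d -> d <= d0 ->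
  \forall n \near \oo, 1 - e <= \sum_j p n j * expR (w n j - d * w n j ^+ 2).
Proof.
move=> e0; set K := 2 * s ^+ 2 + s ^+ 4 / 4.
have K0 : 0 <= K.
  have s2 := sqr_ge0 s.
  have s4 : 0 <= s ^+ 4 by rewrite -[4%N]/(2 * 2)%N exprM sqr_ge0.
  by rewrite /K; lra.
have K1 : 0 < 1 + K by rewrite ltr_pwDl.
pose m := Num.min (e / 2) 1; have m0 : 0 < m by rewrite lt_min divr_gt0 // ltr01.
exists (m / (1 + K)); first by rewrite divr_gt0.
move=> d d0; rewrite ler_pdivlMr // => hd.
have me : m <= e / 2 by rewrite ge_min lexx.
have m1 : m <= 1 by rewrite ge_min lexx orbT.
have dK : d * K <= m by move: hd; rewrite mulrDr mulr1; lra.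
have hF := Flim_lower d0 (le_trans dK m1).
have := gaussian_moment_cvg d0; move=> /cvgrPdist_lt /(_ (e / 2)) []; first by rewrite divr_gt0.
move=> N _ hN; near=> n; have /hN /= : (N <= n)%N by near: n; exact: nbhs_infty_ge.
rewrite ltr_norml => /andP[_].
by rewrite -/K in hF; lra.
Unshelve. all: by end_near. Qed.

(** The damped mass is almost 1 by [moment_lower] and the whole mass is at most
    slightly larger than 1, so damping loses little. *)
Lemma tail_small (e : R) : 0 < e -> exists2 d0 : R, 0 < d0 & forall d, 0 < d -> d <= d0 ->
  \forall n \near \oo, tail d n <= e.
Proof.
move=> e0; have e20 : 0 < e / 2 by rewrite divr_gt0.
have [d0 d00 h] := moment_lower e20.
exists d0 => // d dp dd0; near=> n.
have h1 : 1 - e / 2 <= \sum_j p n j * expR (w n j - d * w n j ^+ 2) by near: n; exact: h.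
have h2 : \sum_j p n j * expR (w n j) <= 1 + e / 2 by near: n; exact: mass_le.
by rewrite tailE; lra.
Unshelve. all: by end_near. Qed.

Lemma mass_cvg : (fun n => \sum_j p n j * expR (w n j)) @ \oo --> (1 : R).
Proof.
apply/cvgrPdist_le => e e0; have [d0 d00 h] := moment_lower e0.
near=> n; rewrite distrC ler_norml; apply/andP; split.
  have : 1 - e <= \sum_j p n j * expR (w n j - d0 * w n j ^+ 2) by near: n; exact: h.
  have := tail_ge0 n (ltW d00); rewrite tailE; lra.
have : \sum_j p n j * expR (w n j) <= 1 + e by near: n; exact: mass_le.
lra.
Unshelve. all: by end_near. Qed.

End Core.

(** * Gaussian averaging from both sides *)

Section DoubleAverage.
Variable (R : realType) (k : nat -> nat).
Variables (p w : forall n, 'I_(k n) -> R) (m : forall n, 'I_(k n) -> 'I_(k n) -> R[i]).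
Arguments p : clear implicits.
Arguments w : clear implicits.
Arguments m : clear implicits.
Hypothesis p_ge0 : forall n j, 0 <= p n j.
Hypothesis p_sum : forall n, \sum_j p n j = 1.
Variables (chi : R -> R[i]) (G al : R[i]).
Hypothesis char_cvg : forall t : R,
  ctends (fun n => \sum_j (p n j)%:C * cis (t * w n j)) (chi t).

Let H n (a b : R) := \sum_i \sum_j m n i j * cis (a * w n i) * cis (b * w n j).

Hypothesis H_le : forall n a b, normc (H n a b) <= 1.
Hypothesis H_cvg : forall a b,
  ctends (fun n => H n a b) (G * cexp (- (a%:C * al) - b%:C * al^*) * chi (a + b)).

Variable d : R.
Hypothesis d0 : 0 < d.

(** The product f (x + i al) f (x + i conj al) for the entire extension f of
    [fdelta d]: in a Gaussian average of characters, a factor exp (- a al) moves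
    the argument by i al. *)
Definition gshift (x : R) : R[i] :=
  cexp ((x - d * x ^+ 2 + d * complex.Re (al ^+ 2)) +i*
        (complex.Re al - 2 * d * x * complex.Re al)).

Let q := d^-1.
Let u : R[i] := 0 +i* (- (2 * d)^-1).
Let q0 : 0 < q. Proof. by rewrite invr_gt0. Qed.
Let K (z : R[i]) : R[i] := cexp ((z + u) ^+ 2 / (q *+ 2)%:C).
(* E has the same limit as H, but is a sum over the law (p, w). *)
Let E n a b := G * cexp (- (a%:C * al) - b%:C * al^*) *
  \sum_j (p n j)%:C * cis ((a + b) * w n j).
Let D := normc al.
Let iw n j : R[i] := 0 +i* w n j.
Arguments iw : clear implicits.

Let cis_iw n j a : cexp (iw n j * a%:C) = cis (a * w n j).
Proof. by rewrite /iw imagM /cis mulrC. Qed.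

Let E_le n a b : normc (E n a b) <= normc G * expR (D * `|a|) * expR (D * `|b|).
Proof.
rewrite /E (normcM (G * _)) (normcM G) -!mulrA ler_wpM2l ?normc_ge0 //.
rewrite -[leRHS]mulr1 ler_pM ?normc_ge0 //; last first.
  by apply: (@normc_sum_p R k p p_ge0 p_sum) => j; rewrite normc_cis.
rewrite normc_cexp -expRD ler_expR.
have h1 : `|complex.Re al| <= D by exact: Re_le_normc.
have h2 (x : R) : - (x * complex.Re al) <= D * `|x|.
  apply: le_trans (ler_norm _) _.
  by rewrite normrN normrM mulrC ler_wpM2r.
apply: le_trans (lerD (h2 a) (h2 b)).
rewrite le_eqVlt; apply/orP; left; apply/eqP.
by case: (al) => x y /=; ring.
Qed.

Let S n (a : R) : R[i] :=
  \sum_j (\sum_i m n i j * cis (a * w n i)) * K (iw n j)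
  + \sum_j - (G * (p n j)%:C * cexp (- (a%:C * al)) * cis (a * w n j)) * K (iw n j - al^*).

(* For fixed a, the difference H - E as one exponential sum in b, over two copies
   of the index set; S is its Gaussian average. *)
Let c1 n a (x : 'I_(k n) + 'I_(k n)) : R[i] :=
  match x with
  | inl j => \sum_i m n i j * cis (a * w n i)
  | inr j => - (G * (p n j)%:C * cexp (- (a%:C * al)) * cis (a * w n j))
  end.
Let z1 n (x : 'I_(k n) + 'I_(k n)) : R[i] :=
  match x with inl j => iw n j | inr j => iw n j - al^* end.

Let expsum1 n a b : expsum (@c1 n a) (@z1 n) b = H n a b - E n a b.
Proof.
rewrite /expsum big_sumType /=; congr (_ + _).
  rewrite /H exchange_big /=; apply: eq_bigr => j _.
  by rewrite mulr_suml; apply: eq_bigr => i _; rewrite cis_iw.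
rewrite /E mulr_sumr -sumrN; apply: eq_bigr => j _.
have e1 : cexp ((iw n j - al^*) * b%:C) = cis (b * w n j) * cexp (- (b%:C * al^*)).
  by rewrite mulrBl cexpD cis_iw [al^* * _]mulrC.
rewrite e1 (cexpD (- _)) [(a + b) * _]mulrDl cisD; ring.
Qed.

Let gavg1 n a : gavg q u (@c1 n a) (@z1 n) = S n a.
Proof. by rewrite /gavg big_sumType. Qed.

Let bound1 n a b : normc (expsum (@c1 n a) (@z1 n) b) <=
  ((1 + normc G) * expR (D * `|a|)) * expR (D * `|b|).
Proof.
have D0 : 0 <= D by exact: normc_ge0.
rewrite expsum1; apply: le_trans (le_normcD _ _) _; rewrite normcN !mulrDl mul1r.
apply: lerD; last exact: E_le.
apply: le_trans (H_le n a b) _; rewrite -expRD -expR0 ler_expR.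
by rewrite addr_ge0 // mulr_ge0.
Qed.

Let diff_cvg a b : ctends (fun n => expsum (@c1 n a) (@z1 n) b) 0.
Proof.
have := ctendsB (H_cvg a b)
  (ctendsZ (G * cexp (- (a%:C * al) - b%:C * al^*)) (char_cvg (a + b))).
by rewrite subrr; apply: ctends_ext => n; rewrite expsum1.
Qed.

Let S_cvg a : ctends (fun n => S n a) 0.
Proof.
have h := @gavg_cvg R q 0 u 0 0 ((1 + normc G) * expR (D * `|a|)) D
  (fun n => ('I_(k n) + 'I_(k n))%type) (fun n => @c1 n a) (fun n => @z1 n) q0 (lexx 0)
  (fun n b => bound1 n a b).
have {h} := h _; rewrite !mul0r; move=> h; apply: ctends_ext (h _) => [n|b]; first exact: gavg1.
by rewrite mul0r; exact: diff_cvg.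
Qed.

Let S_le : exists M : R, forall n a, normc (S n a) <= M * expR (D * `|a|).
Proof.
have [M hM] := gavg_bounded D u q0.
exists (M * (1 + normc G)) => n a; rewrite -gavg1 -mulrA; apply: hM => b; exact: bound1.
Qed.

(* S as an exponential sum in a. *)
Let c2 n (x : 'I_(k n) + 'I_(k n)) : R[i] :=
  match x with
  | inl i => \sum_j m n i j * K (iw n j)
  | inr j => - (G * (p n j)%:C * K (iw n j - al^*))
  end.
Let z2 n (x : 'I_(k n) + 'I_(k n)) : R[i] :=
  match x with inl j => iw n j | inr j => iw n j - al end.

Let expsum2 n a : expsum (@c2 n) (@z2 n) a = S n a.
Proof.
rewrite /expsum big_sumType /=; congr (_ + _).
  under eq_bigr do rewrite mulr_suml.
  rewrite exchange_big /=; apply: eq_bigr => j _.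
  rewrite mulr_suml; apply: eq_bigr => i _; rewrite cis_iw; ring.
apply: eq_bigr => j _.
have e1 : cexp ((iw n j - al) * a%:C) = cis (a * w n j) * cexp (- (a%:C * al)).
  by rewrite mulrBl cexpD cis_iw [al * _]mulrC.
rewrite e1; ring.
Qed.

Let KS_cvg : ctends (fun n => \sum_i \sum_j m n i j * K (iw n j) * K (iw n i)
   - G * \sum_j (p n j)%:C * (K (iw n j - al^*) * K (iw n j - al))) 0.
Proof.
have [M hM] := S_le.
have h := @gavg_cvg R q 0 u 0 0 M D
  (fun n => ('I_(k n) + 'I_(k n))%type) (fun n => @c2 n) (fun n => @z2 n) q0 (lexx 0).
have {h} := h _ _; rewrite !mul0r; move=> h; apply: ctends_ext (h _ _) => [n|n a|a].
- rewrite /gavg big_sumType /=; congr (_ + _).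
    by apply: eq_bigr => i _; rewrite mulr_suml.
  rewrite mulr_sumr -sumrN; apply: eq_bigr => j _; rewrite -/(K _); ring.
- by rewrite expsum2.
- by rewrite mul0r; apply: ctends_ext (S_cvg a) => n; rewrite expsum2.
Qed.

Let K_fdelta n j : (expR (1 / (8 * d)))%:C * K (iw n j) = (fdelta d (w n j))%:C.
Proof.
rewrite /K /iw /u imagD sqr_imag real_div cexp_real -rmorphM; congr (_%:C).
rewrite -expRD /fdelta; congr expR; rewrite /q; field; rewrite gt_eqF //.
Qed.

Let K_gshift n j :
  (expR (1 / (4 * d)))%:C * (K (iw n j - al^*) * K (iw n j - al)) = gshift (w n j).
Proof.
rewrite -cexp_real /K -!cexpD /gshift; congr cexp.
rewrite -mulrDl -fmorphV /iw /u /q.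
case: al => x y; apply/eqP; rewrite eq_complex !expr2 /=; have dn : d != 0 by rewrite gt_eqF.
by apply/andP; split; apply/eqP; field; rewrite dn.
Qed.

(** H and E have the same limits, by [H_cvg] and [char_cvg], so their difference
    tends to 0 at all frequencies (a, b). Its Gaussian average in b, and then in
    a, tends to 0 as well. The kernel has q = 1 / d and linear term - i a / (2 d),
    for which the character of x averages to [fdelta d x], up to the factor
    exp (1 / (8 d)). *)
Lemma double_average : ctends (fun n =>
  \sum_i \sum_j m n i j * (fdelta d (w n i))%:C * (fdelta d (w n j))%:C
   - G * \sum_j (p n j)%:C * gshift (w n j)) 0.
Proof.
have := ctendsZ (expR (1 / (4 * d)))%:C KS_cvg; rewrite mulr0; apply: ctends_ext => n.
rewrite mulrBr; congr (_ - _).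
  rewrite mulr_sumr; apply: eq_bigr => i _; rewrite mulr_sumr; apply: eq_bigr => j _.
  rewrite -(K_fdelta i) -(K_fdelta j).
  have -> : expR (1 / (4 * d)) = expR (1 / (8 * d)) * expR (1 / (8 * d)).
    by rewrite -expRD; congr expR; field; rewrite gt_eqF.
  rewrite rmorphM; ring.
rewrite mulrCA; congr (_ * _); rewrite mulr_sumr; apply: eq_bigr => j _.
by rewrite mulrCA K_gshift.
Qed.

End DoubleAverage.

(** * The quasi-characteristic function *)

Section QuasiCharacteristic.
Variable R : realType.
Local Notation C := R[i].

Definition qlin m (h : 'cV[R]_m) (J : 'M[C]_m) (x : 'cV[R]_m) : C :=
  (0 +i* \sum_(i < m) x i 0 * h i 0)
   - 2^-1 * \sum_(i < m) \sum_(j < m) (x i 0 * x j 0)%:C * J j i.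

Definition qcross m (J : 'M[C]_m) (x y : 'cV[R]_m) : C :=
  \sum_(i < m) \sum_(j < m) (x i 0 * y j 0)%:C * J j i.

Lemma gauss_qcharE m (h : 'cV[R]_m) (J : 'M[C]_m) r (xi : 'I_r -> 'cV[R]_m) :
  gauss_qchar h J xi = cexp (\sum_t qlin h J (xi t)
    - \sum_(t < r) \sum_(u < r | (t < u)%N) qcross J (xi t) (xi u)).
Proof. by []. Qed.

(** The sequence x, xi_1, ..., xi_r, y. *)
Definition flank T r (x : T) (xi : 'I_r -> T) (y : T) (t : 'I_r.+2) : T :=
  if unlift ord0 t is Some t' then
    if unlift ord_max t' is Some t'' then xi t'' else y
  else x.

Lemma flank_first T r (x : T) (xi : 'I_r -> T) y : flank x xi y ord0 = x.
Proof. by rewrite /flank unlift_none. Qed.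

Lemma widen_lift r (t : 'I_r) : widen_ord (leqnSn r) t = lift ord_max t.
Proof. exact/val_inj/esym/lift_max. Qed.

Lemma flank_mid T r (x : T) (xi : 'I_r -> T) y t :
  flank x xi y (lift ord0 (widen_ord (leqnSn r) t)) = xi t.
Proof. by rewrite /flank liftK widen_lift liftK. Qed.

Lemma flank_last T r (x : T) (xi : 'I_r -> T) y : flank x xi y (lift ord0 ord_max) = y.
Proof. by rewrite /flank liftK unlift_none. Qed.

Lemma big_flank (M : Type) (idx : M) (op : Monoid.law idx)
    T r (x : T) (xi : 'I_r -> T) y (F : T -> M) :
  \big[op/idx]_(t < r.+2) F (flank x xi y t) =
  op (F x) (op (\big[op/idx]_t F (xi t)) (F y)).
Proof.
rewrite big_ord_recl flank_first big_ord_recr /= flank_last; congr (op _ (op _ _)).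
by apply: eq_bigr => t _; rewrite flank_mid.
Qed.

Lemma prod_flank (K : numClosedFieldType) n
    T r (x : T) (xi : 'I_r -> T) y (F : T -> 'M[K]_n) :
  \prod_(t < r.+2) F (flank x xi y t) = F x *m (\prod_t F (xi t)) *m F y.
Proof. by rewrite big_flank /= -mulmxA. Qed.

Lemma sum_pairs_flank (V : zmodType) T r (x : T) (xi : 'I_r -> T) y (F : T -> T -> V) :
  \sum_(t < r.+2) \sum_(u < r.+2 | (t < u)%N) F (flank x xi y t) (flank x xi y u) =
  (\sum_t F x (xi t) + F x y)
   + (\sum_(t < r) \sum_(u < r | (t < u)%N) F (xi t) (xi u) + \sum_t F (xi t) y).
Proof.
rewrite big_ord_recl; congr (_ + _).
  rewrite flank_first big_mkcond big_ord_recl /= add0r big_ord_recr /= flank_last.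
  by congr (_ + _); apply: eq_bigr => t _; rewrite flank_mid.
rewrite big_ord_recr /= -[RHS]addr0; congr (_ + _); last first.
  by rewrite big1 // => u; rewrite /bump leq0n add1n ltnNge -ltnS (ltn_ord u).
rewrite -big_split; apply: eq_bigr => t _.
rewrite flank_mid big_mkcond big_ord_recl /= add0r big_ord_recr /= flank_last.
congr (_ + _); last by rewrite /bump /= !add1n ltnS ltn_ord.
rewrite [RHS]big_mkcond; apply: eq_bigr => u _.
by rewrite flank_mid /bump /= !add1n ltnS.
Qed.

Variables (d : nat) (mu : 'cV[R]_d) (s : R) (kappa : 'cV[C]_d) (Sigma : 'M[C]_d).
Let J : 'M[C]_(d + 1) := block_mx Sigma kappa (kappa ^t*) ((s ^+ 2)%:C)%:M.
Let h : 'cV[R]_(d + 1) := col_mx mu (- (s ^+ 2 / 2))%:M.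

Definition embX (x : 'cV[R]_d) : 'cV[R]_(d + 1) := col_mx x 0%:M.
Definition embY (a : R) : 'cV[R]_(d + 1) := col_mx 0 a%:M.

Lemma qcross_block x y (a b : R) :
  qcross J (col_mx x a%:M) (col_mx y b%:M) =
  qcross Sigma x y + b%:C * \sum_i (x i 0)%:C * (kappa i 0)^*
   + a%:C * \sum_j (y j 0)%:C * kappa j 0 + (a * b * s ^+ 2)%:C.
Proof.
rewrite /qcross /J big_split_ord /= big_ord1.
under eq_bigr do rewrite big_split_ord /= big_ord1.
rewrite big_split_ord /= big_ord1 big_split /=.
rewrite !addrA; congr (_ + _ + _ + _).
- apply: eq_bigr => i _; apply: eq_bigr => j _.
  by rewrite block_mxEul !col_mxEu.
- rewrite mulr_sumr; apply: eq_bigr => i _.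
  rewrite block_mxEdl col_mxEu col_mxEd !mxE eqxx mulr1n rmorphM /=; ring.
- rewrite mulr_sumr; apply: eq_bigr => i _.
  rewrite block_mxEur col_mxEu col_mxEd !mxE eqxx mulr1n rmorphM /=; ring.
- by rewrite block_mxEdr !col_mxEd !mxE !eqxx !mulr1n -rmorphM.
Qed.

Lemma qlin_block x (a : R) :
  qlin h J (col_mx x a%:M) = qlin mu Sigma x
   + (0 +i* (- (s ^+ 2 / 2))) * a%:C - (s ^+ 2 * a ^+ 2 / 2)%:C
   - 2^-1 * a%:C * \sum_i (x i 0)%:C * ((kappa i 0)^* + kappa i 0).
Proof.
rewrite /qlin -!/(qcross _ _ _) qcross_block.
have -> : \sum_i col_mx x a%:M i 0 * h i 0 = \sum_i x i 0 * mu i 0 + (- (s ^+ 2 / 2)) * a.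
  rewrite /h big_split_ord /= big_ord1; congr (_ + _).
    by apply: eq_bigr => i _; rewrite !col_mxEu.
  by rewrite !col_mxEd !mxE eqxx !mulr1n mulrC.
have -> : \sum_i (x i 0)%:C * ((kappa i 0)^* + kappa i 0) =
  \sum_i (x i 0)%:C * (kappa i 0)^* + \sum_i (x i 0)%:C * kappa i 0.
  by rewrite -big_split; apply: eq_bigr => i _; rewrite mulrDr.
rewrite -imagD -(imagM (- _)).
have e2 : (2^-1 : C) = (2^-1)%:C by rewrite fmorphV rmorph_nat.
have -> : (s ^+ 2 * a ^+ 2 / 2)%:C = 2^-1 * (a * a * s ^+ 2)%:C.
  by rewrite e2 -rmorphM; congr (_%:C); field.
ring.
Qed.

Lemma qcross0l m (M : 'M[C]_m) y : qcross M 0 y = 0.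
Proof. by rewrite /qcross big1 // => i _; rewrite big1 // => j _; rewrite mxE !mul0r. Qed.

Lemma qcross0r m (M : 'M[C]_m) x : qcross M x 0 = 0.
Proof. by rewrite /qcross big1 // => i _; rewrite big1 // => j _; rewrite mxE mulr0 mul0r. Qed.

Lemma qlin0 m (v : 'cV[R]_m) (M : 'M[C]_m) : qlin v M 0 = 0.
Proof.
rewrite /qlin -/(qcross M 0 0) qcross0l mulr0 subr0 big1 // => i _.
by rewrite mxE mul0r.
Qed.

Let lin0 (f : 'I_d -> C) : \sum_i ((0 : 'cV[R]_d) i 0)%:C * f i = 0.
Proof. by rewrite big1 // => i _; rewrite mxE mul0r. Qed.

(** The covariance of the observable x . X with the last coordinate. *)
Definition kap (x : 'cV[R]_d) : C := \sum_j (x j 0)%:C * kappa j 0.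

Lemma conj_kap x : (kap x)^* = \sum_j (x j 0)%:C * (kappa j 0)^*.
Proof.
rewrite /kap rmorph_sum; apply: eq_bigr => j _; rewrite rmorphM; congr (_ * _).
exact: conjc_real.
Qed.

Lemma qlin_embX x : qlin h J (embX x) = qlin mu Sigma x.
Proof. by rewrite qlin_block expr0n /= !mulr0 !mul0r !subr0 addr0. Qed.

Lemma qlin_embY a : qlin h J (embY a) =
  (0 +i* (- (s ^+ 2 / 2))) * a%:C - (s ^+ 2 * a ^+ 2 / 2)%:C.
Proof. by rewrite qlin_block qlin0 lin0 mulr0 subr0 add0r. Qed.

Lemma qcross_XX x y : qcross J (embX x) (embX y) = qcross Sigma x y.
Proof. by rewrite qcross_block !mul0r !addr0. Qed.

Lemma qcross_YX a y : qcross J (embY a) (embX y) = a%:C * kap y.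
Proof. by rewrite qcross_block qcross0l lin0 rmorph0 !mulr0 !mul0r rmorph0 !add0r addr0. Qed.

Lemma qcross_XY x b : qcross J (embX x) (embY b) = b%:C * (kap x)^*.
Proof.
by rewrite qcross_block qcross0r lin0 rmorph0 !mulr0 !mul0r rmorph0 !addr0 add0r conj_kap.
Qed.

Lemma qcross_YY a b : qcross J (embY a) (embY b) = (a * b * s ^+ 2)%:C.
Proof. by rewrite qcross_block qcross0l !lin0 !mulr0 !add0r. Qed.

Definition kapsum r (xi : 'I_r -> 'cV[R]_d) : C := \sum_t kap (xi t).

(** Flanking by exp (i a Y) and exp (i b Y), with Y the last coordinate,
    contributes the characteristic function of Y and the cross terms with xi.
    These involve kappa on the left and its conjugate on the right, because the
    factors do not commute. *)
Lemma gauss_qchar_flank r (xi : 'I_r -> 'cV[R]_d) (a b : R) :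
  gauss_qchar h J (flank (embY a) (fun t => embX (xi t)) (embY b)) =
  gauss_qchar mu Sigma xi * cexp (- (a%:C * kapsum xi) - b%:C * (kapsum xi)^*) * phi s (a + b).
Proof.
rewrite !gauss_qcharE (big_flank _ _ _ _ (qlin h J)) sum_pairs_flank.
rewrite /phi /cgauss -!cexpD; congr cexp.
rewrite !qlin_embY qcross_YY /=.
under eq_bigr do rewrite qlin_embX.
under [X in _ - (X + _ + _)]eq_bigr do rewrite qcross_YX.
under [X in _ - (_ + (_ + X))]eq_bigr do rewrite qcross_XY.
under [X in _ - (_ + (X + _))]eq_bigr do under eq_bigr do rewrite qcross_XX.
rewrite -!mulr_sumr -/(kapsum xi).
have -> : \sum_t (kap (xi t))^* = (kapsum xi)^* by rewrite /kapsum rmorph_sum.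
have -> : (s ^+ 2 * (a + b) ^+ 2 / 2)%:C =
   (s ^+ 2 * a ^+ 2 / 2)%:C + (s ^+ 2 * b ^+ 2 / 2)%:C + (a * b * s ^+ 2)%:C.
  by rewrite -!rmorphD; congr (_%:C); field.
rewrite [(a + b)%:C]rmorphD /=; ring.
Qed.

Lemma gauss_qchar_embY (t : R) : gauss_qchar h J (fun _ : 'I_1 => embY t) = phi s t.
Proof.
rewrite gauss_qcharE !big_ord1 big_mkcond big_ord1 /= subr0 qlin_embY.
by rewrite /phi /cgauss addrC.
Qed.

(** The mean enters the exponent linearly. *)
Lemma gauss_qchar_shift r (xi : 'I_r -> 'cV[R]_d) :
  gauss_qchar (mu + map_mx (fun z : C => complex.Re z) kappa) Sigma xi =
  gauss_qchar mu Sigma xi * cis (complex.Re (kapsum xi)).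
Proof.
rewrite !gauss_qcharE /cis -cexpD; congr cexp.
rewrite addrAC; congr (_ + _).
have ReS (I : Type) (l : seq I) (F : I -> C) :
    complex.Re (\sum_(i <- l) F i) = \sum_(i <- l) complex.Re (F i).
  by apply: (big_morph _ (@ReD R)).
have iS (I : Type) (l : seq I) (F : I -> R) :
    (0 +i* \sum_(i <- l) F i) = \sum_(i <- l) (0 +i* F i) :> C.
  by apply: (big_morph (fun x : R => (0 +i* x)%C : C)) => // x y; rewrite imagD.
rewrite /kapsum ReS iS -big_split; apply: eq_bigr => t _ /=.
rewrite /qlin addrAC; congr (_ + _); rewrite imagD; congr (0 +i* _).
rewrite /kap ReS -big_split; apply: eq_bigr => i _ /=.
rewrite !mxE mulrDr; congr (_ + _).
by case: (kappa i 0) => y z /=; rewrite mul0r subr0.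
Qed.

End QuasiCharacteristic.

(** * Operator estimates in a fixed state *)

Lemma compare_arith (R : realType) (l o b c t : R) : c * t <= (b + t) * t ->
  1 - l ^+ 2 + (o * l + b * o + (t * b + c * t)) <= 1 - l ^+ 2 + o * (l + b) + t * (2 * b + t).
Proof. lra. Qed.

Section OneState.
Variables (R : realType) (k : nat).
Implicit Types (rho sigma tau A B L O U V P : 'M[R[i]]_k).
Local Notation Re := (@complex.Re R).

Lemma nrm_diff_unitary rho U V : state rho -> U \is unitarymx -> V \is unitarymx ->
  nrm rho (V - U) ^+ 2 = 2 - 2 * Re (ip rho V U).
Proof.
move=> hr hU hV; have h := hr.1.
have e1 W : W \is unitarymx -> ip rho W W = 1.
  by move=> hW; rewrite /ip unitaryVl // mulmx1 hr.2.
rewrite nrm_sqr // (ip_add V (- U) h) ipNr ipNl ipNr opprK (e1 V hV) (e1 U hU).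
move: (ip rho V U) => [a b] /=; ring.
Qed.

(** Change one outer factor at a time and apply Cauchy-Schwarz. *)
Lemma bilinear_diff_le rho A A' B B' U : state rho -> U \is unitarymx ->
  normc (\tr (rho *m (A *m U *m B)) - \tr (rho *m (A' *m U *m B'))) <=
  nrm rho ((A - A')^t*) * nrm rho B + nrm rho (A'^t*) * nrm rho (B - B').
Proof.
move=> hr hU.
have -> : \tr (rho *m (A *m U *m B)) - \tr (rho *m (A' *m U *m B')) =
  \tr (rho *m ((A - A') *m U *m B)) + \tr (rho *m (A' *m U *m (B - B'))).
  by rewrite -mxtraceD -mulmxDr mulmxBl mulmxBl mulmxBr addrA subrK mulmxBr raddfB.
by apply: le_trans (le_normcD _ _) _; apply: lerD; exact: ip_unitary_le.
Qed.

Lemma nrm_distC rho A B : nrm rho (A - B) = nrm rho (B - A).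
Proof. by rewrite -nrmN opprB. Qed.

Lemma unitary_swap_le rho Q U U' V V' : state rho -> Q \is unitarymx ->
  U' \is unitarymx -> V \is unitarymx ->
  normc (\tr (rho *m (U *m Q *m U')) - \tr (rho *m (V *m Q *m V'))) <=
  nrm rho (V^t* - U^t*) + nrm rho (V' - U').
Proof.
move=> hr hQ hU' hV; apply: le_trans (bilinear_diff_le U V U' V' hr hQ) _.
have hV' : V^t* \is unitarymx by rewrite trmxC_unitary.
have e1 := nrm_unitary1 hr hU'; have e2 := nrm_unitary1 hr hV'.
by rewrite e1 e2 mulr1 mul1r ctmxB (nrm_distC _ _ (U^t*)) (nrm_distC _ V').
Qed.

Lemma trace_sqr_nrm rho A : psd rho -> observable A ->
  \tr (rho *m (A *m A)) = (nrm rho A ^+ 2)%:C.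
Proof. by move=> h /hermsymE hA; rewrite -(ip_nrm h A) /ip hA. Qed.

Lemma trace_sqr_eq rho A A' : observable rho -> observable A -> observable A' ->
  A *m rho = A' *m rho -> \tr (rho *m (A *m A)) = \tr (rho *m (A' *m A')).
Proof.
move=> /hermsymE hr /hermsymE hA /hermsymE hA' e.
have e' : rho *m A = rho *m A'.
  by have := congr1 (fun X : 'M[R[i]]_k => X^t*) e; rewrite !ctmxM hr hA hA'.
rewrite (mulmxA rho A) e' (mxtrace_mulC _ A) (mulmxA A rho) e.
by rewrite -(mulmxA A' rho) (mxtrace_mulC A') -mulmxA.
Qed.

(** The singular part tau has trace 1 - ||L||^2, and this bounds |Tr tau U|. *)
Lemma nrm_lr_le sigma rho L : state rho -> state sigma -> sqrt_lr sigma rho L ->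
  nrm rho L <= 1 /\
  forall U, U \is unitarymx ->
    normc (\tr (sigma *m U) - \tr (rho *m (L *m U *m L))) <= 1 - nrm rho L ^+ 2.
Proof.
move=> hr hs [hL [tau [ht hp hsig]]].
have /hermsymE Lh := hL.1.
have trL : \tr (L *m rho *m L) = (nrm rho L ^+ 2)%:C.
  by rewrite -(ip_nrm hr.1) /ip Lh -(mulmxA L rho) (mxtrace_mulC L) -mulmxA.
have trt : \tr tau = (1 - nrm rho L ^+ 2)%:C.
  have e : \tr sigma = (nrm rho L ^+ 2)%:C + \tr tau by rewrite hsig mxtraceD trL.
  apply: (addrI (nrm rho L ^+ 2)%:C).
  by rewrite -e hs.2 -(rmorphD (real_complex R)) addrC subrK.
have n1 : (nrm tau 1%:M ^+ 2)%:C = (1 - nrm rho L ^+ 2)%:C.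
  by rewrite -(ip_nrm ht) /ip ctmx1 !mulmx1 trt.
have n1' : nrm tau 1%:M ^+ 2 = 1 - nrm rho L ^+ 2 by apply: complexI.
split.
  apply: le_of_sqr => //; rewrite expr1n -subr_ge0 -n1'; exact: sqr_ge0.
move=> U hU.
have -> : \tr (sigma *m U) - \tr (rho *m (L *m U *m L)) = ip tau 1%:M (U *m 1%:M).
  rewrite hsig mulmxDl mxtraceD /ip ctmx1 mul1mx mulmx1.
  have -> : \tr (L *m rho *m L *m U) = \tr (rho *m (L *m U *m L)).
    by rewrite -!mulmxA mxtrace_mulC -!mulmxA.
  by rewrite addrAC subrr add0r.
apply: le_trans (normc_ip ht _ _) _.
by rewrite (nrm_unitary _ _ hU) -expr2 n1'.
Qed.

Lemma eig_lw B j : pd B -> eig B j = expR (lw B j / 2).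
Proof.
by move=> hB; rewrite /lw mulrAC divff // mul1r lnK // posrE pd_eig_gt0.
Qed.

Lemma nrm_pd rho B : psd rho -> pd B ->
  nrm rho B ^+ 2 = \sum_j pr rho B j * expR (lw B j).
Proof.
move=> hr hB; rewrite {1}(pd_udiag hB) nrm_udiag //; apply: eq_bigr => j _.
rewrite normc_real ger0_norm ?expR_ge0 // expr2 -expRD.
by have -> : lw B j / 2 + lw B j / 2 = lw B j by field.
Qed.

Definition smooth (d : R) B := udiag (spectralmx B) (fun j => (fdelta d (lw B j))%:C).

Lemma smooth_obs d B : observable (smooth d B).
Proof. exact: real_udiag_obs. Qed.

(** Pointwise, (1 - u)^2 <= 1 - u^2 for u = exp (- d x^2 / 2). *)
Lemma nrm_smooth rho d B : psd rho -> pd B -> 0 <= d ->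
  nrm rho (B - smooth d B) ^+ 2 <=
  \sum_j pr rho B j * (expR (lw B j) * (1 - expR (- (d * lw B j ^+ 2)))).
Proof.
move=> hr hB d0.
have -> : B - smooth d B = udiag (spectralmx B)
    (fun j => (expR (lw B j / 2))%:C - (fdelta d (lw B j))%:C).
  by rewrite /smooth -udiagB -(pd_udiag hB).
rewrite nrm_udiag //; apply: ler_sum => j _.
apply: ler_wpM2l; first exact: pr_ge0.
rewrite -rmorphB normc_real real_normK ?num_real // /fdelta.
set x := lw B j; pose e := expR (- (d * x ^+ 2 / 2)).
have -> : expR (x / 2 - d * x ^+ 2 / 2) = expR (x / 2) * e by rewrite -expRD.
have -> : expR (- (d * x ^+ 2)) = e * e by rewrite -expRD; congr expR; field.
have -> : expR x = expR (x / 2) * expR (x / 2) by rewrite -expRD; congr expR; field.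
have e0 : 0 <= e by exact: expR_ge0.
have e1 : e <= 1 by rewrite -expR0 ler_expR oppr_le0 divr_ge0 // mulr_ge0 // sqr_ge0.
rewrite -subr_ge0.
have -> : expR (x / 2) * expR (x / 2) * (1 - e * e) - (expR (x / 2) - expR (x / 2) * e) ^+ 2
  = 2 * (expR (x / 2) ^+ 2 * (e * (1 - e))) by ring.
by rewrite mulr_ge0 // mulr_ge0 ?sqr_ge0 // mulr_ge0 // subr_ge0.
Qed.

Lemma trace_truncated rho B M : psd rho -> pd B ->
  Re (\tr (rho *m (B *m B) *m (1%:M - mtrunc M B))) =
  \sum_j pr rho B j * (expR (lw B j) * (if expR (lw B j / 2) <= M then 0 else 1)).
Proof.
move=> hr hB; have hP := spectral_unitarymx B.
rewrite /mtrunc hfunE -(udiag1 hP) udiagB -mulmxA.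
have -> : B *m B *m udiag (spectralmx B) (fun j => 1 - (if `|eig B j| <= M then 1 else 0)) =
   udiag (spectralmx B) (fun j => (expR (lw B j / 2))%:C * (expR (lw B j / 2))%:C *
     (1 - (if `|eig B j| <= M then 1 else 0))).
  by rewrite -(udiagM _ _ hP) -(udiagM _ _ hP) -(pd_udiag hB).
rewrite trace_pr //.
rewrite (_ : \sum_j _ = (\sum_j pr rho B j *
  (expR (lw B j) * (if expR (lw B j / 2) <= M then 0 else 1)))%:C) //.
rewrite rmorph_sum; apply: eq_bigr => j _.
have -> : expR (lw B j) = expR (lw B j / 2) * expR (lw B j / 2).
  by rewrite -expRD; congr expR; field.
rewrite (eig_lw j hB) ger0_norm ?expR_ge0 // !rmorphM /= -!mulrA; congr (_ * (_ * (_ * _))).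
by case: ifP => _; [rewrite subrr | rewrite subr0].
Qed.

(** Pass from Tr sigma U to Tr rho (L U L), then to Tr rho (B U B) with
    B = L + O, then to the smoothed B. *)
Lemma compare_smooth rho sigma L O U (dl : R) : state rho -> state sigma ->
  sqrt_lr sigma rho L -> observable O -> pd (L + O) -> U \is unitarymx ->
  normc (\tr (sigma *m U) - \tr (rho *m (smooth dl (L + O) *m U *m smooth dl (L + O)))) <=
  (1 - nrm rho L ^+ 2 + nrm rho O * (nrm rho L + nrm rho (L + O))) +
   nrm rho (L + O - smooth dl (L + O)) *
     (2 * nrm rho (L + O) + nrm rho (L + O - smooth dl (L + O))).
Proof.
move=> hr hs hL hO hB hU; set B := L + O; set T := smooth dl B; set t := nrm rho (B - T).
have hBo : B^t* = B by apply/hermsymE; exact: hB.1.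
have hTo : T^t* = T by apply/hermsymE; exact: smooth_obs.
have hOo : O^t* = O by apply/hermsymE.
have h1 := (nrm_lr_le hr hs hL).2 U hU.
have LB : L - B = - O by rewrite /B opprD addrA subrr add0r.
have h2 := bilinear_diff_le L B L B hr hU.
rewrite LB ctmxN hOo hBo !nrmN in h2.
have h3 := bilinear_diff_le B T B T hr hU.
rewrite ctmxB hBo hTo -/t in h3.
have hT : nrm rho T <= nrm rho B + t.
  have -> : T = B - (B - T) by rewrite opprB addrC subrK.
  exact: nrmB hr.1 _ _.
have t0 : 0 <= t by exact: nrm_ge0.
have h4 : nrm rho T * t <= (nrm rho B + t) * t by exact: ler_wpM2r.
set a := \tr (sigma *m U) in h1 *; set b := \tr (rho *m (L *m U *m L)) in h1 h2.
set c := \tr (rho *m (B *m U *m B)) in h2 h3; set e := \tr (rho *m (T *m U *m T)) in h3 *.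
have -> : a - e = (a - b) + ((b - c) + (c - e)) by ring.
apply: (le_trans (le_normcD _ _)).
apply: (le_trans (lerD h1 (le_trans (le_normcD _ _) (lerD h2 h3)))).
exact: compare_arith.
Qed.

End OneState.

(** * The damped weights for small damping *)

Section GShift.
Variable R : realType.
Local Notation Re := (@complex.Re R).

Lemma lipschitz1 (f f' : R -> R) :
  (forall x, is_derive x (1 : R) f (f' x)) -> (forall x, `|f' x| <= 1) ->
  forall x, `|f x - f 0| <= `|x|.
Proof.
move=> df f1 x.
have cf (a b : R) : {within `[a, b], continuous f}.
  apply: continuous_subspaceT => y; apply: differentiable_continuous.
  by apply/derivable1_diffP; have [] := df y.
have [x0|x0] := lerP 0 x.
  have [c _ ->] := MVT_segment x0 (fun y _ => df y) (cf _ _).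
  by rewrite subr0 normrM ler_piMl.
have [c _ e] := MVT_segment (ltW x0) (fun y _ => df y) (cf _ _).
by rewrite distrC e sub0r normrM normrN ler_piMl.
Qed.

Lemma normc_cis_sub1 (t : R) : normc (cis t - 1) <= 2 * `|t|.
Proof.
apply: le_trans (normc_le_ReIm _) _; rewrite mulr_natl mulr2n /cis /cexp /= expR0.
rewrite mul1r !mul0r subr0 addr0 mul1r; apply: lerD.
  rewrite -cos0; apply: (@lipschitz1 _ (fun x => - sin x)) => x.
  by rewrite normrN sin_max.
rewrite subr0 -[X in `|X|]subr0 -[in X in _ - X]sin0; apply: (@lipschitz1 _ cos) => x.
exact: cos_max.
Qed.

(** Besides the damping itself, [gshift] differs from exp x * cis (Re al) by a
    constant factor exp (d * Re (al ^+ 2)) and by a phase. The phase error is at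
    most 4 d |x| |Re al| exp (- d x^2), which is of order sqrt d uniformly in x
    because 2 sqrt d |x| <= 1 + d x^2 <= exp (d x^2). *)
Lemma gshift_close (al : R[i]) (d x : R) : 0 < d ->
  normc (gshift al d x - (expR x)%:C * cis (Re al)) <=
  expR x * (`|expR (d * Re (al ^+ 2)) - 1| + 2 * `|Re al| * Num.sqrt d)
   + expR x * (1 - expR (- (d * x ^+ 2))).
Proof.
move=> d0; pose r := Re al; pose y := d * Re (al ^+ 2).
pose u := expR (- (d * x ^+ 2)); pose th := - (2 * d * x * r).
have u0 : 0 <= u by exact: expR_ge0.
have u1 : u <= 1 by rewrite -expR0 ler_expR oppr_le0 mulr_ge0 ?sqr_ge0 // ltW.
have gE : gshift al d x - (expR x)%:C * cis r =
    (expR x)%:C * cis r *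
      (u%:C * cis th * ((expR y)%:C - 1) + u%:C * (cis th - 1) + (u%:C - 1)).
  have -> : gshift al d x = (expR x)%:C * cis r * (u%:C * cis th * (expR y)%:C).
    rewrite /gshift /u -!cexp_real /cis -!cexpD; congr cexp.
    by apply/eqP; rewrite eq_complex /=; apply/andP; split; apply/eqP; rewrite /y /th /r; ring.
  ring.
have hth : u * normc (cis th - 1) <= 2 * `|r| * Num.sqrt d.
  apply: (le_trans (ler_wpM2l u0 (normc_cis_sub1 th))).
  have -> : `|th| = 2 * `|r| * (Num.sqrt d * (Num.sqrt d * `|x|)).
    rewrite mulrA -(expr2 (Num.sqrt d)) sqr_sqrtr ?(ltW d0) // /th normrN !normrM.
    by rewrite (ger0_norm (ltW d0)) ger0_norm //; ring.
  set q := Num.sqrt d; have q0 : 0 <= q by exact: sqrtr_ge0.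
  have hx : 2 * (q * `|x|) * u <= 1.
    have -> : u = (expR (d * x ^+ 2))^-1 by rewrite /u expRN.
    rewrite ler_pdivrMr ?expR_gt0 // mul1r; apply: le_trans (expR_ge1Dx _).
    have -> : d * x ^+ 2 = (q * `|x|) ^+ 2.
      by rewrite exprMn real_normK ?num_real // sqr_sqrtr // ltW.
    rewrite -subr_ge0.
    have -> : 1 + (q * `|x|) ^+ 2 - 2 * (q * `|x|) = (q * `|x| - 1) ^+ 2 by ring.
    exact: sqr_ge0.
  have -> : u * (2 * (2 * `|r| * (q * (q * `|x|)))) =
    2 * `|r| * q * (2 * (q * `|x|) * u) by ring.
  by rewrite ler_piMr // !mulr_ge0.
rewrite gE normcM normcM normc_cis mulr1 normc_real ger0_norm ?expR_ge0 // -mulrDr.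
apply: ler_wpM2l; first exact: expR_ge0.
apply: (le_trans (le_normcD _ _)); apply: lerD; last first.
  rewrite -[1 : R[i]]/(1%:C) -(rmorphB (real_complex R)) normc_real distrC.
  by rewrite ger0_norm // subr_ge0.
apply: (le_trans (le_normcD _ _)); apply: lerD.
  rewrite normcM normcM normc_cis mulr1 normc_real ger0_norm //.
  rewrite -[1 : R[i]]/(1%:C) -(rmorphB (real_complex R)) normc_real.
  by rewrite ler_piMl.
by rewrite normcM normc_real ger0_norm.
Qed.

Lemma gshift_mean k (p w : 'I_k -> R) (al : R[i]) (d : R) :
  (forall j, 0 <= p j) -> 0 < d ->
  normc (\sum_j (p j)%:C * gshift al d (w j) - cis (Re al)) <=
  `|\sum_j p j * expR (w j) - 1| +
  (\sum_j p j * expR (w j)) * (`|expR (d * Re (al ^+ 2)) - 1| + 2 * `|Re al| * Num.sqrt d)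
   + \sum_j p j * (expR (w j) * (1 - expR (- (d * w j ^+ 2)))).
Proof.
move=> p0 d0; set be := \sum_j p j * expR (w j).
have -> : \sum_j (p j)%:C * gshift al d (w j) - cis (Re al) =
  (be - 1)%:C * cis (Re al)
   + \sum_j (p j)%:C * (gshift al d (w j) - (expR (w j))%:C * cis (Re al)).
  have -> : \sum_j (p j)%:C * (gshift al d (w j) - (expR (w j))%:C * cis (Re al)) =
      \sum_j (p j)%:C * gshift al d (w j) - be%:C * cis (Re al).
    rewrite /be rmorph_sum mulr_suml -sumrB; apply: eq_bigr => j _.
    by rewrite (rmorphM (real_complex R)) /=; ring.
  rewrite rmorphB /=; ring.
rewrite -addrA; apply: (le_trans (le_normcD _ _)); apply: lerD.
  by rewrite normcM normc_cis mulr1 normc_real.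
apply: (le_trans (normc_sum _ _ _)); rewrite /be mulr_suml -big_split.
apply: ler_sum => j _; rewrite normcM normc_real (ger0_norm (p0 j)).
apply: (le_trans (ler_wpM2l (p0 j) (gshift_close al (w j) d0))).
by rewrite mulrDr /= (mulrA _ _ (_ + _)).
Qed.

End GShift.

(** * The limit under sigma *)

Lemma defect_bounds (R : realDomainType) (b l o : R) :
  0 <= l -> l <= 1 -> 0 <= o -> 0 <= b -> b <= l + o ->
  0 <= 1 - l ^+ 2 + o * (l + b) <= 2 * (`|b - 1| + o) + o * (2 + `|b - 1|).
Proof.
move=> l0 l1 o0 b0 h; have h6 := ler_norm (b - 1).
have h7 : 1 - b <= `|b - 1| by rewrite distrC ler_norm.
apply/andP; split; first by apply: addr_ge0; [nra | apply: mulr_ge0 => //; exact: addr_ge0].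
apply: lerD; first by nra.
by apply: ler_wpM2l => //; lra.
Qed.

Section Assembly.
Variables (R : realType) (k : nat -> nat) (rho sigma : forall n, 'M[R[i]]_(k n)).
Hypotheses (hrho : forall n, state (rho n)) (hsigma : forall n, state (sigma n)).
Variables (d : nat) (X : forall n, 'I_d -> 'M[R[i]]_(k n)).
Hypothesis hX : forall n i, observable (@X n i).
Variable L : forall n, 'M[R[i]]_(k n).
Hypothesis hL : forall n, sqrt_lr (sigma n) (rho n) (L n).
Variables (mu : 'cV[R]_d) (s : R) (kappa : 'cV[R[i]]_d) (Sigma : 'M[R[i]]_d).
Variable O : forall n, 'M[R[i]]_(k n).
Hypotheses (hO : forall n, observable (O n)) (hO2 : o_L2 rho O).
Hypothesis hpos : forall n, pd (L n + O n).
Variable Ot : forall n, 'M[R[i]]_(k n).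
Hypothesis hOt : forall n, observable (Ot n).
Hypothesis hOtD : o_D (fun n => mlog (L n + O n)) rho Ot.
Hypothesis hconv : qconv_gauss rho
       (fun n => rcons_obs (X n) (2 *: mlog (L n + O n) - Ot n))
       (col_mx mu (- (s ^+ 2 / 2))%:M)
       (block_mx Sigma kappa (kappa ^t*) ((s ^+ 2)%:C)%:M).
Local Notation Re := (@complex.Re R).

Let B n := L n + O n.
Let Z n := mlog (B n).
Let W n := 2 *: Z n - Ot n.
Let p n := pr (rho n) (B n).
Let w n := lw (B n).
Arguments p : clear implicits.
Arguments w : clear implicits.
Let U n (a : R) := udiag (spectralmx (B n)) (fun j => cis (a * w n j)).
Let V n (a : R) := mexpi (a%:C *: W n).
Let Xi n (x : 'cV[R]_d) := mexpi (\sum_(i < d) (x i 0)%:C *: X n i).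

Let psdr n : psd (rho n) := (hrho n).1.
Let hP n : spectralmx (B n) \is unitarymx := spectral_unitarymx (B n).

Let UE n a : U n a = mexpi ((2 * a)%:C *: Z n).
Proof.
by rewrite /Z mexpi_mlog /U; apply: eq_udiag => j; congr cis; rewrite /w; field.
Qed.

Let obsZ n : observable (Z n). Proof. exact: mlog_obs. Qed.

Let obsW n : observable (W n).
Proof.
have -> : W n = 2%:R%:C *: Z n - Ot n by rewrite rmorph_nat.
by apply: obsB; [apply: obsZr | exact: hOt].
Qed.

Let unitU n a : U n a \is unitarymx.
Proof. by apply: udiag_unitary => // j; rewrite cis_conj cisVK. Qed.

Let unitV n a : V n a \is unitarymx.
Proof. by apply: mexpi_unitary; apply: obsZr. Qed.

Let adjU n a : (U n a)^t* = U n (- a).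
Proof. by rewrite /U adj_udiag; apply: eq_udiag => j; rewrite cis_conj mulNr. Qed.

Let adjV n a : (V n a)^t* = V n (- a).
Proof. by rewrite /V adj_mexpi ?rmorphN ?scaleNr //; apply: obsZr. Qed.

Let unitXi n x : Xi n x \is unitarymx.
Proof. by apply: mexpi_unitary; apply: obs_sum => i; apply: obsZr. Qed.

Let sum_embX n x :
  mexpi (\sum_(i < d + 1) (embX x i 0)%:C *: rcons_obs (X n) (W n) i) = Xi n x.
Proof.
congr mexpi; rewrite big_split_ord /= big_ord1 col_mxEd mxE mulr1n scale0r addr0.
apply: eq_bigr => i _; rewrite col_mxEu; congr (_ *: _).
by rewrite /rcons_obs (unsplitK (inl i)).
Qed.

Let sum_embY n a :
  mexpi (\sum_(i < d + 1) (embY d a i 0)%:C *: rcons_obs (X n) (W n) i) = V n a.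
Proof.
congr mexpi; rewrite big_split_ord /= big_ord1 col_mxEd mxE eqxx mulr1n big1 ?add0r.
  by rewrite /rcons_obs (unsplitK (inr _)).
by move=> i _; rewrite col_mxEu mxE scale0r.
Qed.

Let traceV_cvg a : ctends (fun n => \tr (rho n *m V n a)) (phi s a).
Proof.
have /ctendsP := @hconv 1%N (fun _ : 'I_1 => embY d a).
rewrite gauss_qchar_embY; apply: ctends_ext => n; rewrite big_ord1.
by rewrite sum_embY.
Qed.

Let VE n a : V n a = mexpi ((2 * a)%:C *: Z n + (- a)%:C *: Ot n).
Proof.
congr mexpi; rewrite /W scalerBr scalerA rmorphN scaleNr; congr (_ *: _ - _).
by rewrite rmorphM mulrC rmorph_nat.
Qed.

(** The limit is known for W, and is the same for 2 Z by the hypothesis on Ot. *)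
Let traceU_cvg a : ctends (fun n => \tr (rho n *m U n a)) (phi s a).
Proof.
have [l [/ctendsP h1 /ctendsP h2]] := @hOtD 1%N (fun _ : 'I_1 => 2 * a) (fun _ => - a).
have e : l = phi s a.
  apply: ctends_unique h1 _; apply: ctends_ext (traceV_cvg a) => n.
  by rewrite big_ord1 VE.
by rewrite -e; apply: ctends_ext h2 => n; rewrite big_ord1 UE.
Qed.

Let char_cvg a : ctends (fun n => \sum_j (p n j)%:C * cis (a * w n j)) (phi s a).
Proof. by apply: ctends_ext (traceU_cvg a) => n; rewrite trace_pr. Qed.

(** By [nrm_diff_unitary] it is enough that the inner product of V and U tends
    to 1. Its limit is unchanged when V a is replaced by U a, by the hypothesis on
    Ot for two factors. *)
Let VU_cvg a : (fun n => nrm (rho n) (V n a - U n a)) @ \oo --> (0 : R).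
Proof.
apply: cvg_sqr0.
have [l [/ctendsP h1 /ctendsP h2]] := @hOtD 2%N
  (fun t : 'I_2 => if t == ord0 then 2 * (- a) else 2 * a)
  (fun t : 'I_2 => if t == ord0 then a else 0).
have e2 n (F : 'I_2 -> 'M[R[i]]_(k n)) :
    \tr (rho n *m \prod_(t < 2) F t) = \tr (rho n *m (F ord0 *m F (lift ord0 ord0))).
  by rewrite big_ord_recl big_ord1.
have l1 : l = 1.
  apply: ctends_unique h2 _; apply: ctends_ext (ctends_cst 1) => n.
  rewrite e2 /= -!UE -adjU unitaryVl // mulmx1; exact: (esym (hrho n).2).
have ipc : ctends (fun n => ip (rho n) (V n a) (U n a)) 1.
  rewrite -l1; apply: ctends_ext h1 => n.
  by rewrite e2 /= scale0r addr0 -UE /ip adjV VE opprK.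
have h3 := ctends_Re ipc.
have h4 : (fun n => 2 - 2 * Re (ip (rho n) (V n a) (U n a))) @ \oo --> (0 : R).
  rewrite (_ : 0 = 2 - 2 * Re (1 : R[i])); last by rewrite /= mulr1 subrr.
  by apply: cvgB; [exact: cvg_cst | apply: cvgM => //; exact: cvg_cst].
by apply: cvg_trans h4; apply: near_eq_cvg; apply: nearW => n; rewrite nrm_diff_unitary.
Qed.

Let nO := fun n => nrm (rho n) (O n).
Let nL := fun n => nrm (rho n) (L n).
Let nB := fun n => nrm (rho n) (B n).

Let nO_cvg : nO @ \oo --> (0 : R).
Proof.
apply: cvg_sqr0; apply/ctends_real; move/ctendsP: hO2; apply: ctends_ext => n.
exact: trace_sqr_nrm.
Qed.

Let nL_le1 n : nL n <= 1.
Proof. by have [] := nrm_lr_le (hrho n) (hsigma n) (hL n). Qed.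

Let nB_sqr n : nB n ^+ 2 = \sum_j p n j * expR (w n j).
Proof. exact: nrm_pd. Qed.

Let nB_ge0 n : 0 <= nB n. Proof. exact: nrm_ge0. Qed.
Let nO_ge0 n : 0 <= nO n. Proof. exact: nrm_ge0. Qed.
Let nL_ge0 n : 0 <= nL n. Proof. exact: nrm_ge0. Qed.

Let p_ge0 n j : 0 <= p n j. Proof. exact: pr_ge0. Qed.
Let p_sum n : \sum_j p n j = 1. Proof. exact: pr_sum1. Qed.

Let eventually_le (f : nat -> R) (e : R) :
  f @ \oo --> (0 : R) -> 0 < e -> \forall n \near \oo, f n <= e.
Proof.
move=> /cvgrPdist_le h /h; apply: filterS => n /=; rewrite sub0r normrN.
exact: le_trans (ler_norm _).
Qed.

(** The mass is ||B||^2, and ||B|| <= ||L|| + ||O|| <= 1 + ||O||. *)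
Let mass_le (e : R) : 0 < e -> \forall n \near \oo, \sum_j p n j * expR (w n j) <= 1 + e.
Proof.
move=> e0; pose x := Num.min (e / 3) 1; have x0 : 0 < x by rewrite lt_min divr_gt0 // ltr01.
have xe : x <= e / 3 by rewrite ge_min lexx.
have x1 : x <= 1 by rewrite ge_min lexx orbT.
apply: filterS (eventually_le nO_cvg x0) => n hn; rewrite -nB_sqr.
have h1 : nB n <= 1 + x.
  apply: le_trans (nrmD (psdr n) _ _) _; exact: lerD (nL_le1 n) hn.
have := nB_ge0 n; nra.
Qed.

Let nB_cvg : (fun n => `|nB n - 1|) @ \oo --> (0 : R).
Proof.
have h := @mass_cvg R k p w s p_ge0 p_sum char_cvg mass_le.
apply: (@squeeze_cvgr _ _ _ _ (cst 0) (fun n => `|\sum_j p n j * expR (w n j) - 1|)).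
- apply: nearW => n; rewrite normr_ge0 -nB_sqr /=.
  have -> : nB n ^+ 2 - 1 = (nB n - 1) * (nB n + 1) by ring.
  by rewrite normrM ler_peMr // ger0_norm ?addr_ge0 // lerDr.
- exact: cvg_cst.
- have hh : (fun n => \sum_j p n j * expR (w n j) - 1) @ \oo --> (0 : R).
    by rewrite -[X in _ --> X](subrr (1 : R)); apply: cvgB => //; exact: cvg_cst.
  by have := cvg_norm hh; rewrite normr0; apply.
Qed.

(** The error of replacing Tr sigma U by Tr rho (B U B); see [compare_smooth]. *)
Let defect n := 1 - nL n ^+ 2 + nO n * (nL n + nB n).

Let defect_cvg : defect @ \oo --> (0 : R).
Proof.
apply: (@squeeze_cvgr _ _ _ _ (cst 0)
  (fun n => 2 * (`|nB n - 1| + nO n) + nO n * (2 + `|nB n - 1|))).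
- apply: nearW => n; apply: defect_bounds;
    [exact: nL_ge0|exact: nL_le1|exact: nO_ge0|exact: nB_ge0|].
  exact: (nrmD (psdr n)).
- exact: cvg_cst.
- have e0 : (0 : R) = 2 * (0 + 0) + 0 * (2 + 0) by ring.
  rewrite [X in _ --> X]e0.
  apply: cvgD; first by apply: cvgM; [exact: cvg_cst|exact: cvgD].
  by apply: cvgM => //; apply: cvgD => //; exact: cvg_cst.
Qed.

Section Target.
Variables (r : nat) (xi : 'I_r -> 'cV[R]_d).

Let Pi n : 'M[R[i]]_(k n) := \prod_(t < r) Xi n (xi t).
Let G := gauss_qchar mu Sigma xi.
Let al := kapsum kappa xi.

Let unitPi n : Pi n \is unitarymx.
Proof. by apply: unitary_prod => t; exact: unitXi. Qed.

Let VPiV_cvg a b : ctends (fun n => \tr (rho n *m (V n a *m Pi n *m V n b)))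
  (G * cexp (- (a%:C * al) - b%:C * al^*) * phi s (a + b)).
Proof.
pose F n (x : 'cV[R]_(d + 1)) : 'M[R[i]]_(k n) :=
  mexpi (\sum_(i < d + 1) (x i 0)%:C *: rcons_obs (X n) (W n) i).
have FX n x : F n (embX x) = Xi n x by exact: sum_embX.
have FY n c : F n (embY d c) = V n c by exact: sum_embY.
have e n : \prod_(t < r.+2) F n (flank (embY d a) (fun t => embX (xi t)) (embY d b) t) =
    V n a *m Pi n *m V n b.
  have eP : \prod_t F n (embX (xi t)) = Pi n by apply: eq_bigr => t _; exact: FX.
  by rewrite prod_flank !FY eP.
have /ctendsP := @hconv r.+2 (flank (embY d a) (fun t => embX (xi t)) (embY d b)).
rewrite gauss_qchar_flank; apply: ctends_ext => n.
exact: (congr1 (fun M => \tr (rho n *m M)) (e n)).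
Qed.

(** [VU_cvg] replaces V by U at both ends of the product. *)
Let UPiU_cvg a b : ctends (fun n => \tr (rho n *m (U n a *m Pi n *m U n b)))
  (G * cexp (- (a%:C * al) - b%:C * al^*) * phi s (a + b)).
Proof.
rewrite -[X in ctends _ X]addr0.
have h : ctends (fun n => \tr (rho n *m (U n a *m Pi n *m U n b)) -
    \tr (rho n *m (V n a *m Pi n *m V n b))) 0.
  apply: (@ctends_squeeze _ _ _
    (fun n => nrm (rho n) (V n (- a) - U n (- a)) + nrm (rho n) (V n b - U n b))).
    apply: nearW => n; rewrite subr0.
    rewrite -adjU -adjV.
    exact: (unitary_swap_le (U n a) (V n b) (hrho n) (unitPi n)
      (unitU n b) (unitV n a)).
  have := cvgD (VU_cvg (- a)) (VU_cvg b); rewrite addr0; exact.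
by apply: ctends_ext (ctendsD (VPiV_cvg a b) h) => n; rewrite addrC subrK.
Qed.

Let m n i j := (spectralmx (B n) *m rho n *m (spectralmx (B n))^t*) j i *
  (spectralmx (B n) *m Pi n *m (spectralmx (B n))^t*) i j.

Let trace_m n (f g : 'I_(k n) -> R[i]) :
  \tr (rho n *m (udiag (spectralmx (B n)) f *m Pi n *m udiag (spectralmx (B n)) g)) =
  \sum_i \sum_j m i j * f i * g j.
Proof.
rewrite trace_udiag2; apply: eq_bigr => i _; apply: eq_bigr => j _.
by congr (_ * _); rewrite mulrAC.
Qed.

Let smooth_cvg (dl : R) : 0 < dl ->
  ctends (fun n => \tr (rho n *m (smooth dl (B n) *m Pi n *m smooth dl (B n)))
    - G * \sum_j (p n j)%:C * gshift al dl (w n j)) 0.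
Proof.
move=> dl0.
have h := @double_average R k p w m p_ge0 p_sum (phi s) G al char_cvg _ _ dl dl0.
apply: ctends_ext (h _ _) => [n|n a b|a b].
- by rewrite trace_m.
- rewrite -trace_m; apply: le_trans (ip_unitary_le _ _ (hrho n) (unitPi n)) _.
  by rewrite -/(U n a) -/(U n b) adjU !(nrm_unitary1 (hrho n)) ?mulr1.
- by apply: ctends_ext (UPiU_cvg a b) => n; rewrite trace_m.
Qed.

(** The chain Tr sigma Pi, Tr rho (T Pi T), G v, G cis (Re al), where T is B
    damped with dl and v the mean of [gshift]. For dl small and then n large the
    three differences are at most 6 et, et and 6 g et; this is where the
    constant 7 + 6 g comes from. *)
Lemma target_cvg : ctends (fun n => \tr (sigma n *m Pi n)) (G * cis (Re al)).
Proof.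
apply/cvgrPdist_le => e e0; pose g := normc G; pose y := Re (al ^+ 2); pose rr := `|Re al|.
have g0 : 0 <= g by exact: normc_ge0.
have rr0 : 0 <= rr by exact: normr_ge0.
pose et := Num.min 1 (e / (7 + 6 * g)).
have g7 : 0 < 7 + 6 * g by lra.
have et0 : 0 < et by rewrite lt_min ltr01 divr_gt0.
have et1 : et <= 1 by rewrite ge_min lexx.
have ete : et * (7 + 6 * g) <= e by rewrite -ler_pdivlMr // ge_min lexx orbT.
have et2 : 0 < et ^+ 2 by rewrite exprn_gt0.
have [d0 d00 htail] := @tail_small R k p w s p_ge0 p_sum char_cvg mass_le _ et2.
have [d1 d10 hexp] : exists2 d1 : R, 0 < d1 & forall x, `|x| < d1 -> `|expR (x * y) - 1| <= et.
  have hc : (fun x => expR (x * y)) x @[x --> (0 : R)] --> expR (0 * y).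
    apply: (cvg_comp (fun x => x * y) expR); last exact: continuous_expR.
    by apply: cvgM; [exact: cvg_id | exact: cvg_cst].
  rewrite mul0r expR0 in hc.
  move/cvgrPdist_le : hc => /(_ _ et0) /nbhs_ballP [d1 /= d10 h]; exists d1 => // x hx.
  by rewrite distrC; apply: h; rewrite /ball /= sub0r normrN.
(* dl is small for the damping loss, for the factor exp (dl y) and for the phase. *)
pose dl := Num.min d0 (Num.min (d1 / 2) ((et / (2 * rr + 1)) ^+ 2)).
have r1 : 0 < 2 * rr + 1 by lra.
have dl0 : 0 < dl by rewrite !lt_min d00 divr_gt0 // exprn_gt0 // divr_gt0.
have dld0 : dl <= d0 by rewrite ge_min lexx.
have hE : `|expR (dl * y) - 1| <= et.
  apply: hexp; rewrite gtr0_norm //; apply: (@le_lt_trans _ _ (d1 / 2)); last by lra.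
  by rewrite /dl !ge_min lexx orbT.
have hS : 2 * rr * Num.sqrt dl <= et.
  have h : Num.sqrt dl <= et / (2 * rr + 1).
    have x0 : 0 <= et / (2 * rr + 1) by apply: ltW; exact: divr_gt0.
    rewrite -[leRHS](ger0_norm x0) -sqrtr_sqr; apply: ler_wsqrtr.
    by rewrite /dl !ge_min lexx !orbT.
  have h' : (2 * rr + 1) * Num.sqrt dl <= et by rewrite mulrC -ler_pdivlMr.
  have := sqrtr_ge0 dl; nra.
have E1 := eventually_le defect_cvg et0.
have E2 := htail _ dl0 dld0.
have E3 := eventually_le (smooth_cvg dl0) et0.
have E4 := eventually_le nB_cvg ltr01.
have hb : (fun n => `|\sum_j p n j * expR (w n j) - 1|) @ \oo --> (0 : R).
  have hh : (fun n => \sum_j p n j * expR (w n j) - 1) @ \oo --> (0 : R).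
    rewrite -[X in _ --> X](subrr (1 : R)); apply: cvgB; last exact: cvg_cst.
    exact: (@mass_cvg R k p w s p_ge0 p_sum char_cvg mass_le).
  by have := cvg_norm hh; rewrite normr0; apply.
have E5 := eventually_le hb et0.
apply: filterS (filterI E1 (filterI E2 (filterI E3 (filterI E4 E5)))) => n.
move=> [F1 [F2 [F3 [F4 F5]]]].
rewrite sub0r normrN ger0_norm ?normc_ge0 //.
have G1 := compare_smooth dl (hrho n) (hsigma n) (hL n) (hO n) (hpos n) (unitPi n).
have G2 := gshift_mean (w n) al (@p_ge0 n) dl0.
have G3 := nrm_smooth (psdr n) (hpos n) (ltW dl0).
set T := smooth dl (L n + O n) in G1 G3; set t := nrm (rho n) (L n + O n - T) in G1 G3.
have tt : t <= et.
  apply: le_of_sqr; [exact: ltW|]; apply: le_trans G3 _; exact: F2.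
have t0 : 0 <= t by exact: nrm_ge0.
rewrite -/(B n) -/(nB n) -/(nL n) -/(nO n) -/(defect n) in G1.
have nB2 : nB n <= 2 by have := le_trans (ler_norm _) F4; lra.
rewrite subr0 in F3.
set be := \sum_j p n j * expR (w n j) in G2 F5.
have be2 : be <= 2 by have := le_trans (ler_norm _) F5; lra.
set v := \sum_j (p n j)%:C * gshift al dl (w n j) in F3 G2.
have H1 : \tr (sigma n *m Pi n) - G * cis (Re al) =
  (\tr (sigma n *m Pi n) - \tr (rho n *m (T *m Pi n *m T))) +
  ((\tr (rho n *m (T *m Pi n *m T)) - G * v) + G * (v - cis (Re al))) by ring.
rewrite H1; apply: le_trans (le_normcD _ _) _.
have H2 := le_normcD (\tr (rho n *m (T *m Pi n *m T)) - G * v) (G * (v - cis (Re al))).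
rewrite normcM -/g in H2.
have be0 : 0 <= be by apply: sumr_ge0 => j _; rewrite mulr_ge0 ?expR_ge0.
have H3 : normc (v - cis (Re al)) <= 6 * et.
  apply: le_trans G2 _; rewrite -/y -/rr.
  have : be * (`|expR (dl * y) - 1| + 2 * rr * Num.sqrt dl) <= 2 * (et + et).
    apply: ler_pM => //; last exact: lerD.
    by apply: addr_ge0 => //; apply: mulr_ge0; [lra|exact: sqrtr_ge0].
  have F2' : tail p w dl n <= et by nra.
  by rewrite /tail in F2'; lra.
have H4 : g * normc (v - cis (Re al)) <= g * (6 * et) by exact: ler_wpM2l.
have H5 : t * (2 * nB n + t) <= et * 5.
  apply: ler_pM => //; last by lra.
  by have := nB_ge0 n; lra.
rewrite -/T in F3.
apply: le_trans ete.
apply: le_trans (lerD G1 H2) _.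
move: F1 F3 H4 H5; move: (normc _) (normc _) => x1 x2; lra.
Qed.

End Target.

(** If exp (w/2) > M then dl w^2 >= 1, so damping loses at least half of the
    mass there. *)
Let tail_trunc n (dl M : R) : 0 < dl -> expR (1 + 1 / (4 * dl)) <= M ->
  \sum_j p n j * (expR (w n j) * (if expR (w n j / 2) <= M then 0 else 1)) <=
  2 * tail p w dl n.
Proof.
move=> dl0 hM; rewrite /tail mulr_sumr; apply: ler_sum => j _.
rewrite [leRHS]mulrCA; apply: ler_wpM2l; first exact: p_ge0.
rewrite [leRHS]mulrCA; apply: ler_wpM2l; first exact: expR_ge0.
set x := w n j; have u1 : expR (- (dl * x ^+ 2)) <= 1.
  by rewrite -expR0 ler_expR oppr_le0; apply: mulr_ge0; [exact: ltW | exact: sqr_ge0].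
case: ifPn => [_|]; first lra.
rewrite -ltNge => h; have := le_lt_trans hM h; rewrite ltr_expR => hx.
pose t := 1 + 1 / (4 * dl).
have c0 : 0 < 1 / (4 * dl) by rewrite divr_gt0 // mulr_gt0.
have t1 : 1 <= t by rewrite lerDl ltW.
have tdl : 1 <= dl * (4 * t).
  have -> : dl * (4 * t) = 4 * dl + 1 by rewrite /t; field; rewrite gt_eqF.
  by rewrite lerDr mulr_ge0 // ltW.
have hx2 : 1 <= dl * x ^+ 2.
  apply: le_trans tdl _; apply: ler_wpM2l; first exact: ltW.
  rewrite -/t in hx; nra.
have : expR (- (dl * x ^+ 2)) <= 2^-1.
  rewrite expRN lef_pV2 ?posrE ?expR_gt0 //; apply: le_trans (expR_ge1Dx _); lra.
lra.
Qed.

(** [tail_small] covers all large n; for the finitely many others M exceeds all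
    eigenvalues, by the summand M0. *)
Lemma likelihood_unif_integrable : sq_unif_integrable rho B.
Proof.
move=> e e0; have e40 : 0 < e / 4 by rewrite divr_gt0.
have [dl dl0 htail] := @tail_small R k p w s p_ge0 p_sum char_cvg mass_le _ e40.
have [N _ hN] := htail _ dl0 (lexx _).
pose M0 := \sum_(i < N) \sum_j expR (w i j / 2).
have M00 : 0 <= M0 by apply: sumr_ge0 => i _; apply: sumr_ge0 => j _; exact: expR_ge0.
exists (expR (1 + 1 / (4 * dl)) + M0); first by apply: ltr_wpDr => //; exact: expR_gt0.
apply: (@le_lt_trans _ _ (e / 2)%:E); last by rewrite lte_fin; lra.
apply: ge_ereal_sup => _ [n _ <-]; rewrite lee_fin (trace_truncated _ (psdr n) (hpos n)).
have [nN|Nn] := ltnP n N.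
  rewrite big1 ?divr_ge0 ?ltW // => j _; rewrite ifT ?mulr0 //.
  apply: (@le_trans _ _ M0); last by rewrite lerDr expR_ge0.
  rewrite /M0 (bigD1 (Ordinal nN)) //= (bigD1 j) //=.
  rewrite -addrA lerDl; apply: addr_ge0.
    by apply: sumr_ge0 => i _; exact: expR_ge0.
  by apply: sumr_ge0 => i _; apply: sumr_ge0 => l _; exact: expR_ge0.
have h := @tail_trunc n dl (expR (1 + 1 / (4 * dl)) + M0) dl0.
have {}h := h _; apply: le_trans (h _) _; first by rewrite lerDl.
by have := hN n Nn; rewrite /=; lra.
Qed.

(** Any other version L' satisfies L' rho = L rho, so Tr rho L'^2 = Tr rho L^2, and
    O' = B - L' has the same second moment as O. *)
Lemma contiguity : contiguous sigma rho.
Proof.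
move=> L' hL'.
have e n : L n *m rho n = L' n *m rho n by exact: (sqrt_lr_unique (psdr n) (hL n) (hL' n)).
have obsr n : observable (rho n) := (psdr n).1.
have obsL n : observable (L n) by have [[]] := hL n.
have obsL' n : observable (L' n) by have [[]] := hL' n.
have obsBn n : observable (B n) := (hpos n).1.
have BO n : L' n + (B n - L' n) = B n by rewrite addrC subrK.
split.
  apply/ctendsP; apply: (@ctends_squeeze _ _ _ defect); last exact: defect_cvg.
  apply: nearW => n; rewrite -(trace_sqr_eq (obsr n) (obsL n) (obsL' n) (e n)).
  rewrite (trace_sqr_nrm (psdr n) (obsL n)) -/(nL n).
  rewrite -[1 : R[i]]/(1%:C) -(rmorphB (real_complex R)) normc_real distrC.
  have h : 0 <= 1 - nL n ^+ 2.
    by have := nL_le1 n; have := nL_ge0 n; nra.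
  rewrite ger0_norm // /defect lerDl; apply: mulr_ge0; first exact: nO_ge0.
  by apply: addr_ge0; [exact: nL_ge0 | exact: nB_ge0].
exists (fun n => B n - L' n); split.
- by move=> n; exact: (obsB (obsBn n) (obsL' n)).
- apply/ctendsP; move/ctendsP: hO2; apply: ctends_ext => n.
  apply: (trace_sqr_eq (obsr n) (hO n) (obsB (obsBn n) (obsL' n))).
  by rewrite mulmxBl -e -mulmxBl /B [L n + O n]addrC addrK.
- by move=> n; rewrite BO; apply: pd_psd; exact: hpos.
- have -> : (fun n => L' n + (B n - L' n)) = B by apply: functional_extensionality_dep.
  exact: likelihood_unif_integrable.
Qed.

End Assembly.

Theorem theorem6p2 (R : realType) (k : nat -> nat)
    (rho sigma : forall n, 'M[R[i]]_(k n))
    (hrho : forall n, state (rho n)) (hsigma : forall n, state (sigma n))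
    (d : nat) (X : forall n, 'I_d -> 'M[R[i]]_(k n))
    (hX : forall n i, observable (X n i))
    (L : forall n, 'M[R[i]]_(k n))
    (hL : forall n, sqrt_lr (sigma n) (rho n) (L n))
    (mu : 'cV[R]_d) (s : R) (kappa : 'cV[R[i]]_d) (Sigma : 'M[R[i]]_d)
    (hSigma : psd Sigma)
    (hJ : psd (block_mx Sigma kappa (kappa ^t*) ((s ^+ 2)%:C)%:M))
    (O : forall n, 'M[R[i]]_(k n))
    (hO : forall n, observable (O n)) (hO2 : o_L2 rho O)
    (hpos : forall n, pd (L n + O n))
    (Ot : forall n, 'M[R[i]]_(k n))
    (hOt : forall n, observable (Ot n))
    (hOtD : o_D (fun n => mlog (L n + O n)) rho Ot)
    (hconv : qconv_gauss rho
       (fun n => rcons_obs (X n) (2 *: mlog (L n + O n) - Ot n))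
       (col_mx mu (- (s ^+ 2 / 2))%:M)
       (block_mx Sigma kappa (kappa ^t*) ((s ^+ 2)%:C)%:M)) :
  contiguous sigma rho /\
  qconv_gauss sigma X (mu + map_mx (fun z : R[i] => complex.Re z) kappa) Sigma.
Proof.
split.
  by move=> L' hL'; exact: (contiguity hrho hsigma hL hO hO2 hpos hOtD hconv hL').
move=> r xi; apply/ctendsP; rewrite gauss_qchar_shift.
exact: (target_cvg hrho hsigma hX hL hO hO2 hpos hOt hOtD hconv).
Qed.
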